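(* Let $d\geq 2$. There exists $C>0$ such that the following holds. For every finite $\Lambda\subset \mathbb Z^d$ containing $0$, every event $\mathcal A$ measurable with respect to $\mathcal C_e(0)$, and every $\beta',\beta$ with $\beta_c/2\leq \beta'<\beta\leq \beta_c$, $$\big|\phi_{\Lambda, \beta}^0[\mathcal{A}] - \phi_{\Lambda, \beta'}^0[\mathcal{A}]\big| \leq C |\beta - \beta'| \sqrt{\nabla_{\Lambda}(\beta_c)\,\max\{\phi_{\Lambda, \beta}^0[\mathcal{A}], \phi_{\Lambda, \beta'}^0[\mathcal{A}]\}\,\phi_{\Lambda, \beta'}^0\big[|\mathcal C(0)|\big]},$$ where $$\nabla_{\Lambda}(\beta) = \sup_{x \in \Lambda} \sum_{y, z \in \Lambda} \langle \sigma_x \sigma_y \rangle_{\Lambda, \beta} \langle \sigma_y \sigma_z \rangle_{\Lambda, \beta} \langle \sigma_z \sigma_x \rangle_{\Lambda, \beta}.$$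
   Context: For $x,y\in\mathbb Z^d$, write $x\sim y$ if $|x-y|_2=1$. For $\Lambda\subset\mathbb Z^d$ let $E(\Lambda)=\{xy: x,y\in\Lambda,\ x\sim y\}$, and identify $\Lambda$ with the graph $(\Lambda,E(\Lambda))$. Ising model with free boundary conditions: for finite $\Lambda$, $\langle\cdot\rangle_{\Lambda,\beta}$ is the expectation for the probability measure on $\{\pm1\}^\Lambda$ proportional to $\exp(\beta\sum_{xy\in E(\Lambda)}\sigma_x\sigma_y)$. FK-Ising model with free boundary conditions: for finite $\Lambda$ and $\beta\ge0$, $\phi^0_{\Lambda,\beta}$ is the probability measure on $\omega\in\{0,1\}^{E(\Lambda)}$ proportional to $2^{k(\omega)}\prod_{e\in E(\Lambda)}(e^{2\beta}-1)^{\omega_e}$, where $k(\omega)$ is the number of connected components of the graph $(\Lambda,\{e:\omega_e=1\})$. $\phi^0_{\Lambda,\beta}[X]$ also denotes the expectation of a random variable $X$. $\mathcal C(0)$ is the set of vertices connected to $0$ by open edges (vertex cluster), and $\mathcal C_e(0)$ is the set of open edges in the connected component of $0$ (edge cluster). $\beta_c=\beta_c(d)\in(0,\infty)$ is the critical inverse temperature: $\beta_c=\inf\{\beta\ge0:\langle\sigma_0\rangle^+_\beta>0\}$, where $\langle\cdot\rangle_\beta^+$ is the limit as $\Lambda\nearrow\mathbb Z^d$ of the Ising measure on $\{\pm1\}^\Lambda$ with weight proportional to $\exp(\beta\sum_{xy\in E(\Lambda)}\sigma_x\sigma_y+\beta\sum_{x\in\Lambda,\,y\notin\Lambda,\,x\sim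 y}\sigma_x)$. *)

(* Defs.v *)
From HB Require Import structures.
From mathcomp Require Import all_boot all_order all_algebra finmap.
From mathcomp Require Import boolp classical_sets functions fsbigop reals.
From mathcomp Require Import topology normedtype sequences exp.
From mathcomp Require summability.

Set Implicit Arguments.
Unset Strict Implicit.
Unset Printing Implicit Defensive.

Import Order.TTheory GRing.Theory Num.Theory.
Import numFieldNormedType.Exports.

Local Open Scope classical_set_scope.
Local Open Scope ring_scope.

(* Mean of f under the probability measure on the finite set D proportional
   to the weight w. *)
Definition gibbs_mean (R : realType) (I : finType) (D : {set I})
    (w f : I -> R) : R :=
  (\sum_(i in D) w i * f i) / (\sum_(i in D) w i).

(* A finite graph is a finType V with edge set E : {set {set V}}, an edge xy
   being the pair [set x; y]. *)

(* Spin configurations in {+1,-1}^V are encoded by booleans, true being -1. *)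
Definition spin (R : realType) (V : finType) (s : {ffun V -> bool}) (x : V)
  : R := (-1) ^+ s x.

Definition ising_energy (R : realType) (V : finType) (E : {set {set V}})
    (s : {ffun V -> bool}) : R :=
  \sum_(e in E) \prod_(x in e) spin R s x.

Definition ising_mean (R : realType) (V : finType) (E : {set {set V}})
    (b : R) (f : {ffun V -> bool} -> R) : R :=
  gibbs_mean [set: {ffun V -> bool}]%SET
    (fun s => expR (b * ising_energy R E s)) f.

(* A percolation configuration w in {0,1}^E is encoded by its set of open
   edges, so that the sample space is powerset E and w_e is (e \in w). *)
Definition open_adj (V : finType) (w : {set {set V}}) : rel V :=
  fun x y => [set x; y]%SET \in w.

Definition nb_clusters (V : finType) (w : {set {set V}}) : nat :=
  n_comp (open_adj w) predT.

Definition fk_weight (R : realType) (V : finType) (E : {set {set V}})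
    (b : R) (w : {set {set V}}) : R :=
  2 ^+ nb_clusters w * \prod_(e in E) (expR (2 * b) - 1) ^+ (e \in w).

Definition fk_mean (R : realType) (V : finType) (E : {set {set V}})
    (b : R) (X : {set {set V}} -> R) : R :=
  gibbs_mean (powerset E) (fk_weight E b) X.

Definition fk_prob (R : realType) (V : finType) (E : {set {set V}})
    (b : R) (A : {set {set {set V}}}) : R :=
  fk_mean E b (fun w => (w \in A)%:R).

Definition vertex_cluster (V : finType) (o : V) (w : {set {set V}}) : {set V} :=
  [set x | connect (open_adj w) o x]%SET.

Definition edge_cluster (V : finType) (o : V) (w : {set {set V}})
  : {set {set V}} :=
  [set e in w | e \subset vertex_cluster o w]%SET.

(* A belongs to the sigma-algebra on powerset E generated by the edge cluster
   of o, i.e. it is the preimage of some set B of values. *)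
Definition edge_cluster_measurable (V : finType) (E : {set {set V}}) (o : V)
    (A : {set {set {set V}}}) : Prop :=
  exists B : {set {set {set V}}},
    A = [set w in powerset E | edge_cluster o w \in B]%SET.

(* |x - y|_2 = 1, written as |x - y|_2 ^ 2 = 1 to stay within int. *)
Definition nn (d : nat) (x y : 'rV[int]_d) : bool :=
  \sum_(i < d) (x 0 i - y 0 i) ^+ 2 == 1.

Definition lattice_edges (d : nat) (L : {fset 'rV[int]_d}) : {set {set L}} :=
  [set [set x; y] | x in [set: L], y in [set: L] & nn (val x) (val y)]%SET.

Definition two_point (R : realType) (d : nat) (L : {fset 'rV[int]_d}) (b : R)
    (x y : L) : R :=
  ising_mean (lattice_edges L) b (fun s => spin R s x * spin R s y).

Definition triangle (R : realType) (d : nat) (L : {fset 'rV[int]_d}) (b : R)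
  : R :=
  sup (range (fun x : L =>
    \sum_(y : L) \sum_(z : L)
      two_point b x y * two_point b y z * two_point b z x)).

Definition boundary_field (R : realType) (d : nat) (L : {fset 'rV[int]_d})
    (s : {ffun L -> bool}) : R :=
  \sum_(x : L)
    \sum_(y \in [set y : 'rV[int]_d | y \notin L /\ nn (val x) y]) spin R s x.

(* Finite-volume mean of sigma_0 with + boundary condition. When 0 is not in L
   the spin at 0 is a boundary spin, hence +1; such L do not affect the limit
   below. *)
Definition plus_magnetization_fin (R : realType) (d : nat)
    (L : {fset 'rV[int]_d}) (b : R) : R :=
  gibbs_mean [set: {ffun L -> bool}]%SET
    (fun s => expR (b * ising_energy R (lattice_edges L) s
                    + b * boundary_field R s))
    (fun s => oapp (spin R s) 1 (insub (0 : 'rV[int]_d))).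

(* summability.totally is the filter, on the finite subsets of Z^d, of
   increasing exhaustion of Z^d. *)
Definition plus_magnetization (R : realType) (d : nat) (b : R) : R :=
  lim (plus_magnetization_fin L b
         @[L --> @summability.totally 'rV[int]_d]).

Definition beta_c (R : realType) (d : nat) : R :=
  inf [set b : R | 0 <= b /\ 0 < plus_magnetization d b].

(* Main.v *)
(* Let pi_s(C) be the probability at inverse temperature s that the edge cluster
   of 0 is C, and let S be the vertex set of C. By the Edwards-Sokal relation
     pi_s(C) = cst * (e^{2s} - 1)^|C| * e^{s (|E(S^c)| - |E|)} * Z_{S^c}(s) / Z(s)
   with Z the Ising partition functions, so -(log pi_s(C))'' is bounded by a
   multiple of |C| plus Var(H_L) - Var(H_{L \ S}). If that is at most
   K nabla |S|, then, since sum_C pi_b'(C) (log pi(C))'(b') = 0, the relative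
   entropy of pi_b' with respect to pi_b is at most
   K nabla (b - b')^2 E_b'|S|, and a local form of Pinsker's inequality gives
   the theorem.

   For the variance increment, vertices are removed one at a time: if Cov is the
   covariance of two edge energies and w the removed vertex,
     Cov_L(xy, uv) - Cov_{L \ w}(xy, uv)
       <= <xu><yw><wv> + <xw><wu><yv> + (u <-> v),
   whose sum over edges is a triangle diagram. It comes from a finite version of
   the double random current: with t the product of two replicas,
   e^{b (s_e + s'_e)} = 1 + 1[t_e = 1] (e^{2 b s_e} - 1), and expanding over the
   cluster C of x gives Cov_L(xy, uv) = sum_C p(C) <yv>_{L \ C} + (u <-> v),
   where p has total mass <xu>, gives mass <xw><wu> to the C containing w, and,
   on the other C, increases when w is removed, by log-supermodularity of
   the partition function. *)

Require Import Defs.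
From HB Require Import structures.
From mathcomp Require Import all_boot all_order all_algebra finmap.
From mathcomp Require Import boolp classical_sets functions fsbigop reals.
From mathcomp Require Import topology normedtype sequences exp.
From mathcomp Require Import derive realfun ring lra zify.

Import Order.TTheory GRing.Theory Num.Theory.
Import numFieldNormedType.Exports.

Import fintype mathcomp.boot.finset.

Local Open Scope ring_scope.

Set Implicit Arguments.
Unset Strict Implicit.
Unset Printing Implicit Defensive.

(** * Clusters *)

Section Clusters.
Variables (V : finType) (x : V).
Implicit Types (w C E : {set {set V}}) (e T : {set V}).

Definition simple_edges E := forall e, e \in E -> #|e| = 2.

Definition inner T E : {set {set V}} := [set e in E | e \subset T]%SET.

Lemma inner_sub T E : inner T E \subset E.
Proof. by apply/subsetP => e; rewrite inE => /andP[]. Qed.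

Lemma simple_sub E E' : E' \subset E -> simple_edges E -> simple_edges E'.
Proof. by move=> /subsetP sE hE e /sE /hE. Qed.

Lemma innerI T U E : inner T (inner U E) = inner (T :&: U) E.
Proof. by apply/setP => e; rewrite !inE subsetI andbC andbCA andbA. Qed.

Lemma connect_closed (r : rel V) T y :
  x \in T -> (forall a b, a \in T -> r a b -> b \in T) ->
  connect r x y -> y \in T.
Proof.
move=> xT cT /connectP[p]; elim: p x xT => [|b p IH] a aT /=.
  by move=> _ ->.
by move=> /andP[rab pp]; apply: IH (cT _ _ aT rab) pp.
Qed.

Lemma mem_vcluster w : x \in vertex_cluster x w.
Proof. by rewrite inE connect0. Qed.

Lemma vcluster_step w a b :
  a \in vertex_cluster x w -> [set a; b]%SET \in w -> b \in vertex_cluster x w.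
Proof. by rewrite !inE => xa ab; apply: connect_trans xa (connect1 ab). Qed.

Lemma vclusterS w w' : w \subset w' -> vertex_cluster x w \subset vertex_cluster x w'.
Proof.
move=> /subsetP sw; apply/subsetP => y; rewrite inE.
apply: (connect_closed (mem_vcluster w')) => a b aT ab.
exact: vcluster_step aT (sw _ ab).
Qed.

Lemma edge_in_or_out w e : #|e| = 2 -> e \in w ->
  (e \subset vertex_cluster x w) || (e \subset ~: vertex_cluster x w).
Proof.
move=> /eqP/cards2P[a [b [ab ->]]] ew; rewrite !subUset !sub1set !in_setC.
have [ha|ha] := boolP (a \in vertex_cluster x w).
  by rewrite (vcluster_step ha ew).
have [hb|//] := boolP (b \in vertex_cluster x w).
by move: ew ha; rewrite setUC => ew; rewrite (vcluster_step hb ew).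
Qed.

Lemma ecluster_sub w : edge_cluster x w \subset w.
Proof. by apply/subsetP => e; rewrite inE => /andP[]. Qed.

(** A path of open edges from [x] stays in the cluster of [x], so its edges all lie in the edge
    cluster. The vertex cluster is thus a function of the edge cluster. *)
Lemma vcluster_ecluster w : vertex_cluster x (edge_cluster x w) = vertex_cluster x w.
Proof.
apply/eqP; rewrite eqEsubset vclusterS ?ecluster_sub //=.
apply/subsetP => y; rewrite inE.
apply: (connect_closed (mem_vcluster _)) => a b aT ab.
have aS : a \in vertex_cluster x w by apply: subsetP aT; rewrite vclusterS ?ecluster_sub.
apply: vcluster_step aT _; rewrite inE.
by move: (ab); rewrite /open_adj => -> /=; rewrite subUset !sub1set aS (vcluster_step aS ab).
Qed.

(** Edge clusters are therefore the fixed points of [edge_cluster x], and the condition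
    [edge_cluster x C == C] in the sums below selects the possible values. *)
Lemma ecluster_idem w : edge_cluster x (edge_cluster x w) = edge_cluster x w.
Proof.
apply/setP => e; rewrite inE vcluster_ecluster [in LHS]inE [in RHS]inE.
by rewrite -andbA andbb.
Qed.

Lemma ecluster_vcluster C e :
  edge_cluster x C = C -> e \in C -> e \subset vertex_cluster x C.
Proof. by move=> hC; rewrite -{1}hC inE => /andP[]. Qed.

Lemma vclusterU C w : w \subset inner (~: vertex_cluster x C) w ->
  vertex_cluster x (C :|: w) = vertex_cluster x C.
Proof.
move=> /subsetP hw; apply/eqP; rewrite eqEsubset (vclusterS (subsetUl C w)) andbT.
apply/subsetP => y; rewrite inE.
apply: (connect_closed (mem_vcluster _)) => a b aT; rewrite /open_adj in_setU.
case/orP => [|/hw]; first exact: vcluster_step.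
by rewrite inE subUset !sub1set in_setC aT andbF.
Qed.

Lemma eclusterU C w : edge_cluster x C = C -> simple_edges w ->
  w \subset inner (~: vertex_cluster x C) w -> edge_cluster x (C :|: w) = C.
Proof.
move=> hC w2 hw; apply/setP => e; rewrite inE vclusterU // in_setU.
apply/andP/idP => [[/orP[//|ew] eC]|eC]; last by rewrite eC (ecluster_vcluster hC).
have := subsetP hw _ ew; rewrite inE => /andP[_ enC].
(* An edge contained both in the cluster and in its complement would be empty. *)
have : e \subset set0.
  by rewrite -(setICr (vertex_cluster x C)) subsetI eC enC.
by rewrite subset0 => /eqP e0; have := w2 _ ew; rewrite e0 cards0.
Qed.

End Clusters.

(** * Expansion over the cluster of a vertex *)

Section ClusterExpansion.
Variables (R : comNzRingType) (V : finType) (x : V).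
Implicit Types (w C E : {set {set V}}) (T : {set V}) (g : {set V} -> R).

Lemma prod1D_powerset (I : finType) (A : {set I}) (g : I -> R) :
  \prod_(e in A) (1 + g e) = \sum_(w in powerset A) \prod_(e in w) g e.
Proof.
rewrite big_mkcond /=.
rewrite (eq_bigr (fun i => (if i \in A then g i else 0) + 1)); last first.
  by move=> i _; case: ifP => _; rewrite ?add0r // addrC.
rewrite bigA_distr (bigID (fun J : {set I} => J \in powerset A)) /=.
rewrite [X in _ + X]big1 ?addr0; last first.
  move=> J; rewrite powersetE => /subsetPn[i iJ iA].
  by rewrite (bigD1 i) //= iJ (negbTE iA) mul0r.
apply: eq_bigr => J; rewrite powersetE => /subsetP sJ.
rewrite [RHS]big_mkcond; apply: eq_bigr => i _.
by case: ifP => // /sJ ->.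
Qed.

(* The configurations with edge cluster C are C plus arbitrary edges avoiding
   the vertices of C. *)
Lemma sum_ecluster E C g : simple_edges E -> C \subset E -> edge_cluster x C = C ->
  \sum_(w in powerset E | edge_cluster x w == C) \prod_(e in w) g e
  = \prod_(e in C) g e
    * \prod_(e in inner (~: vertex_cluster x C) E) (1 + g e).
Proof.
move=> E2 CE hC; rewrite prod1D_powerset mulr_sumr.
set D := inner _ _.
have Dw w : w \subset D -> w \subset inner (~: vertex_cluster x C) w.
  move=> /subsetP h; apply/subsetP => e ew; have := h _ ew.
  by rewrite !inE ew => /andP[].
have D2 w : w \subset D -> simple_edges w.
  by move=> h; apply: simple_sub (subset_trans h (inner_sub _ _)) E2.
have disjCD w : w \subset D -> [disjoint C & w].
  move=> hw; apply/pred0P => e /=; apply/negP => /andP[eC ew].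
  have := subsetP (Dw _ hw) _ ew; rewrite inE => /andP[_ h1].
  have h2 := ecluster_vcluster hC eC.
  have : e \subset set0 by rewrite -(setICr (vertex_cluster x C)) subsetI h1 h2.
  by rewrite subset0 => /eqP e0; have := D2 _ hw _ ew; rewrite e0 cards0.
rewrite (reindex_onto (fun w => C :|: w) (fun w => w :\: C)) /=; last first.
  move=> w /andP[_ /eqP h]; apply/eqP; rewrite setDE setUIr setUCr setIT.
  by apply/eqP/setUidPr; rewrite -h ecluster_sub.
apply: eq_big => [w|w].
  rewrite !powersetE subUset CE /=; apply/idP/idP.
    case/andP => /andP[wE /eqP hw] /eqP wC; apply/subsetP => e ew.
    rewrite inE (subsetP wE) //=.
    have /orP[eS|] := @edge_in_or_out V x (C :|: w) e (E2 _ (subsetP wE _ ew)) ltac:(by rewrite in_setU ew orbT).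
      have eC : e \in C by rewrite -hw inE in_setU ew orbT eS.
      by move: ew; rewrite -wC in_setD eC.
    by rewrite -vcluster_ecluster hw.
  move=> wD; rewrite (subset_trans wD (inner_sub _ _)) eclusterU ?eqxx //=; auto.
  rewrite setDUl setDv set0U; apply/eqP/setDidPl.
  by rewrite disjoint_sym; exact: disjCD.
case/andP => /andP[_ _] /eqP wC.
have dj : [disjoint C & w] by rewrite disjoint_sym -wC disjoints_subset subsetDr.
by rewrite (eq_bigl [predU C & w]) ?bigU //= => e; rewrite !inE.
Qed.

(** The edges avoiding the cluster of [x] are unconstrained once [C] is fixed, so they resum to a
    full product: the model on the complement is left intact. *)
Lemma cluster_expansion E g : simple_edges E ->
  \prod_(e in E) (1 + g e)
  = \sum_(C in powerset E | edge_cluster x C == C)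
      \prod_(e in C) g e
      * \prod_(e in inner (~: vertex_cluster x C) E) (1 + g e).
Proof.
move=> E2; rewrite prod1D_powerset.
rewrite (partition_big (edge_cluster x)
  (fun C => (C \in powerset E) && (edge_cluster x C == C))) /=.
  by apply: eq_bigr => C /andP[]; rewrite powersetE => CE /eqP hC; rewrite sum_ecluster.
move=> w; rewrite !powersetE => wE.
by rewrite ecluster_idem eqxx (subset_trans (ecluster_sub _ _) wE).
Qed.

End ClusterExpansion.

(** * Averages over spin configurations *)

Section SpinAverage.
Variables (R : realType) (V : finType).
Local Notation cfg := {ffun V -> bool}.
Implicit Types (s t : cfg) (f g : cfg -> R) (e T : {set V}) (l : seq V).

(** The average is normalised over all of [cfg], so that vertices met by no edge contribute a factor
    1. Subgraphs obtained by deleting vertices can then keep the vertex type [V]. *)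
Definition av f : R := #|{: cfg}|%:R^-1 * \sum_s f s.

Definition spins l s : R := \prod_(y <- l) spin R s y.

Definition edge_spin e s : R := \prod_(y in e) spin R s y.

Definition flipc t s : cfg := [ffun y => t y (+) s y].

Lemma eq_av f g : f =1 g -> av f = av g.
Proof. by move=> fg; congr (_ * _); apply: eq_bigr => s _; apply: fg. Qed.

Lemma card_cfg_neq0 : #|{: cfg}|%:R != 0 :> R.
Proof. by rewrite pnatr_eq0 -lt0n; apply/card_gt0P; exists [ffun=> false]. Qed.

Lemma av_cst (c : R) : av (fun=> c) = c.
Proof.
by rewrite /av sumr_const -(mulr_natl c) mulKf ?card_cfg_neq0.
Qed.

Lemma avD f g : av (fun s => f s + g s) = av f + av g.
Proof. by rewrite /av big_split mulrDr. Qed.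

Lemma avZ (c : R) f : av (fun s => c * f s) = c * av f.
Proof. by rewrite /av -mulr_sumr mulrCA. Qed.

Lemma avZr (c : R) f : av (fun s => f s * c) = av f * c.
Proof. by rewrite /av -mulr_suml mulrA. Qed.

Lemma avN f : av (fun s => - f s) = - av f.
Proof. by rewrite /av sumrN mulrN. Qed.

Lemma avB f g : av (fun s => f s - g s) = av f - av g.
Proof. by rewrite avD avN. Qed.

Lemma av_sum (I : finType) (P : pred I) (F : I -> cfg -> R) :
  av (fun s => \sum_(i | P i) F i s) = \sum_(i | P i) av (F i).
Proof. by rewrite /av exchange_big mulr_sumr. Qed.

Lemma av_exchange (F : cfg -> cfg -> R) :
  av (fun s => av (F s)) = av (fun t => av (F^~ t)).
Proof.
rewrite /av; congr (_ * _).
by rewrite -mulr_sumr exchange_big mulr_sumr.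
Qed.

Lemma av_ge0 f : (forall s, 0 <= f s) -> 0 <= av f.
Proof. by move=> f0; rewrite mulr_ge0 ?invr_ge0 ?ler0n ?sumr_ge0. Qed.

Lemma av_gt0 f : (forall s, 0 < f s) -> 0 < av f.
Proof.
move=> f0; rewrite mulr_gt0 // ?invr_gt0.
  by rewrite lt_def card_cfg_neq0 ler0n.
rewrite (bigD1 [ffun=> false]) //= ltr_wpDr ?f0 // sumr_ge0 // => s _.
exact: ltW.
Qed.

Lemma flipcK t : involutive (flipc t).
Proof. by move=> s; apply/ffunP => y; rewrite !ffunE addKb. Qed.

Lemma av_flip t f : av (fun s => f (flipc t s)) = av f.
Proof.
by rewrite /av [in RHS](reindex_inj (inv_inj (flipcK t))).
Qed.

Lemma spin_flip t s y : spin R (flipc t s) y = spin R t y * spin R s y.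
Proof. by rewrite /spin ffunE signr_addb. Qed.

Lemma spins_flip l t s : spins l (flipc t s) = spins l t * spins l s.
Proof. by rewrite /spins -big_split; apply: eq_bigr => y _; rewrite spin_flip. Qed.

Lemma edge_spinE e : edge_spin e =1 spins (enum e).
Proof. by move=> s; rewrite /edge_spin /spins big_enum. Qed.

Lemma edge_spin_flip e t s : edge_spin e (flipc t s) = edge_spin e t * edge_spin e s.
Proof. by rewrite !edge_spinE spins_flip. Qed.

Lemma spins_cat l l' s : spins (l ++ l') s = spins l s * spins l' s.
Proof. by rewrite /spins big_cat. Qed.

Lemma spins_cons y l s : spins (y :: l) s = spin R s y * spins l s.
Proof. by rewrite /spins big_cons. Qed.

Lemma spins_nil s : spins [::] s = 1.
Proof. by rewrite /spins big_nil. Qed.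

Definition spinsE := (spins_cons, spins_nil, mulr1).

Lemma spin_sq s y : spin R s y * spin R s y = 1.
Proof. by rewrite /spin -signr_addb addbb. Qed.

Lemma spins_sq l s : spins l s * spins l s = 1.
Proof. by rewrite /spins -big_split big1 // => y _; exact: spin_sq. Qed.

Lemma spins_cases l s : spins l s = 1 \/ spins l s = -1.
Proof. 
have := spins_sq l s; rewrite -expr2 => /eqP; rewrite sqrf_eq1.
by case/orP => /eqP; [left|right].
Qed.

Lemma edge_spin_cases e s : edge_spin e s = 1 \/ edge_spin e s = -1.
Proof. by rewrite edge_spinE; apply: spins_cases. Qed.

Lemma edge_spin_pair a c s : a != c ->
  edge_spin [set a; c] s = spin R s a * spin R s c.
Proof. by move=> ac; rewrite /edge_spin big_setU1 ?big_set1 // in_set1. Qed.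

Lemma spins_filter l T s :
  spins l s = spins [seq y <- l | y \in T] s * spins [seq y <- l | y \in ~: T] s.
Proof.
rewrite /spins !big_filter (bigID (mem T)) /=; congr (_ * _).
by apply: eq_bigl => y; rewrite in_setC.
Qed.

Definition depends_on T f := forall s t, {in T, s =1 t} -> f s = f t.

Lemma depends_spins T l : {subset l <= T} -> depends_on T (spins l).
Proof.
move=> lT s t st; rewrite /spins big_seq [RHS]big_seq.
by apply: eq_bigr => y /lT yT; rewrite /spin st.
Qed.

Lemma depends_edge T e : e \subset T -> depends_on T (edge_spin e).
Proof.
by move=> eT s t st; rewrite /edge_spin; apply: eq_bigr => y /(subsetP eT) yT; rewrite /spin st.
Qed.

Lemma dependsM T f g : depends_on T f -> depends_on T g ->
  depends_on T (fun s => f s * g s).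
Proof. by move=> fT gT s t st; rewrite (fT s t) ?(gT s t). Qed.

Lemma depends_prod T (E : {set {set V}}) (F : {set V} -> R -> R) :
  (forall e, e \in E -> e \subset T) ->
  depends_on T (fun s => \prod_(e in E) F e (edge_spin e s)).
Proof.
move=> ET s t st; apply: eq_bigr => e eE.
by rewrite (depends_edge (ET e eE) st).
Qed.

Lemma av_indep T f g : depends_on T f -> depends_on (~: T) g ->
  av (fun s => f s * g s) = av f * av g.
Proof.
move=> fT gT.
(* The involution [h] exchanges the coordinates outside [T] of two independent copies, which puts
   the arguments of [f] and [g] into a single configuration. *)
pose mix s t : cfg := [ffun y => if y \in T then s y else t y].
pose h (p : cfg * cfg) := (mix p.1 p.2, mix p.2 p.1).
have hK : involutive h.
  have mixK s t : mix (mix s t) (mix t s) = s.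
    by apply/ffunP => y; rewrite !ffunE; case: ifP => yT; rewrite yT.
  by case=> s t; rewrite /h /= !mixK.
have Hm s t : f s * g t = f (mix s t) * g (mix s t).
  congr (_ * _); first by apply: fT => y yT; rewrite ffunE yT.
  by apply: gT => y; rewrite in_setC ffunE => /negbTE yT; rewrite yT.
suff : \sum_s \sum_t f s * g t = \sum_s \sum_(t : cfg) f s * g s.
  under [in LHS]eq_bigr do rewrite -mulr_sumr.
  under [in RHS]eq_bigr do rewrite sumr_const -(mulr_natl (f _ * _)).
  rewrite -mulr_suml -mulr_sumr => H.
  rewrite /av mulrACA H mulrA; congr (_ * _).
  by rewrite -mulrA mulVf ?mulr1 ?card_cfg_neq0.
rewrite !pair_big /= [RHS](reindex_inj (inv_inj hK)) /=.
by apply: eq_bigr => -[s t] _ /=; rewrite Hm.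
Qed.

(* The change of variables s -> s + t shows Av(spins l) = Av(spins l)^2. *)
Lemma av_spins_ge0 l : 0 <= av (spins l).
Proof.
have -> : av (spins l) = av (spins l) ^+ 2; last exact: sqr_ge0.
have H t : av (spins l) = spins l t * av (spins l).
  by rewrite -avZ -[LHS](av_flip t); apply: eq_av => s; rewrite spins_flip.
by rewrite expr2 -avZr -[LHS]av_cst; apply: eq_av.
Qed.

(** Expanding one factor at a time, the edge spin is absorbed into the list [l]; every term ends as
    a nonnegative multiple of some [av (spins l)]. *)
Lemma av_spins_prod_ge0 (r : seq {set V}) l (a c : {set V} -> R) :
  (forall e, 0 <= a e) -> (forall e, 0 <= c e) ->
  0 <= av (fun s => spins l s * \prod_(e <- r) (a e + c e * edge_spin e s)).
Proof.
move=> a0 c0; elim: r l => [|e r IH] l.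
  under eq_av => s do rewrite big_nil mulr1.
  exact: av_spins_ge0.
rewrite (eq_av (g := fun s =>
    a e * (spins l s * \prod_(e <- r) (a e + c e * edge_spin e s))
  + c e * (spins (l ++ enum e) s * \prod_(e <- r) (a e + c e * edge_spin e s)))).
  by rewrite avD !avZ addr_ge0 // mulr_ge0.
by move=> s; rewrite big_cons spins_cat -edge_spinE; ring.
Qed.

Definition ch (c : R) := (expR c + expR (- c)) / 2.
Definition sh (c : R) := (expR c - expR (- c)) / 2.

Lemma ch_gt0 c : 0 < ch c.
Proof. by rewrite divr_gt0 // addr_gt0 // expR_gt0. Qed.

Lemma sh_ge0 c : 0 <= c -> 0 <= sh c.
Proof. by move=> c0; rewrite divr_ge0 // subr_ge0 ler_expR; lra. Qed.

Lemma sh_gt0 c : 0 < c -> 0 < sh c.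
Proof. by move=> c0; rewrite divr_gt0 // subr_gt0 ltr_expR; lra. Qed.

Lemma ch_ge1 c : 1 <= ch c.
Proof.
have : 0 <= (expR (c / 2) - expR (- (c / 2))) ^+ 2 by exact: sqr_ge0.
have -> : (expR (c / 2) - expR (- (c / 2))) ^+ 2 = 2 * (ch c - 1).
  have e1 : expR c = expR (c / 2) * expR (c / 2) by rewrite -expRD; congr expR; lra.
  have e2 : expR (- c) = expR (- (c / 2)) * expR (- (c / 2)) by rewrite -expRD; congr expR; lra.
  have e3 : expR (c / 2) * expR (- (c / 2)) = 1 by rewrite -expRD subrr expR0.
  rewrite /ch e1 e2; set p := expR _ in e3 *; set q := expR _ in e3 *.
  have -> : (p - q) ^+ 2 = p * p + q * q - 2 * (p * q) by ring.
  by rewrite e3; field.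
by lra.
Qed.

Lemma ch2_sub_sh2 c : ch c ^+ 2 - sh c ^+ 2 = 1.
Proof.
transitivity (expR c * expR (- c)); last by rewrite -expRD subrr expR0.
by rewrite /ch /sh; field.
Qed.

Lemma expR_edge c e s : expR (c * edge_spin e s) = ch c + sh c * edge_spin e s.
Proof.
by rewrite /ch /sh; case: (edge_spin_cases e s) => ->; rewrite ?mulr1 ?mulrN1; field.
Qed.

Lemma gks1_exp (E : {set {set V}}) l (c : {set V} -> R) :
  (forall e, 0 <= c e) ->
  0 <= av (fun s => spins l s * \prod_(e in E) expR (c e * edge_spin e s)).
Proof.
move=> c0; rewrite (eq_av (g := fun s => spins l s *
    \prod_(e <- enum E) (ch (c e) + sh (c e) * edge_spin e s))).
  by apply: av_spins_prod_ge0 => e; rewrite ?sh_ge0 // ltW // ch_gt0.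
by move=> s; rewrite big_enum; under eq_bigr do rewrite expR_edge.
Qed.

End SpinAverage.

(** * Griffiths inequalities *)

Lemma set_ind_sub (I : finType) (P : {set I} -> Prop) (A B : {set I}) :
  A \subset B -> P A ->
  (forall e (D : {set I}), A \subset D -> e \in B -> e \notin D -> P D -> P (e |: D)) -> P B.
Proof.
move=> AB PA IH.
elim: {B}#|B :\: A| {-2}B (erefl #|B :\: A|) AB IH => [|n IHn] B Bn AB IH.
  move/eqP: Bn; rewrite cards_eq0 setD_eq0 => BA.
  by rewrite (_ : B = A) //; apply/eqP; rewrite eqEsubset BA AB.
have /card_gt0P[e] : (0 < #|B :\: A|)%N by rewrite Bn.
rewrite in_setD => /andP[eA eB]; rewrite -(setD1K eB).
have sAB : A \subset B :\ e.
  by apply/subsetP => i iA; rewrite in_setD1 (subsetP AB) // andbT; apply: contraNneq eA => <-.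
apply: (IH) => //; first by rewrite in_setD1 eqxx.
apply: IHn => //.
  apply/eqP; rewrite -eqSS -Bn (cardsD1 e (B :\: A)) in_setD eA eB add1n eqSS.
  by apply/eqP; congr #|pred_of_set _|; apply/setP => i; rewrite !inE andbCA.
move=> i D AD; rewrite in_setD1 => /andP[_ iB]; exact: IH.
Qed.

Section Correlations.
Variables (R : realType) (V : finType).
Local Notation cfg := {ffun V -> bool}.
Implicit Types (s t : cfg) (e T : {set V}) (l : seq V) (E : {set {set V}}) (b : R).

(** Unnormalised correlation of the spins listed in [l], where a repeated vertex cancels in pairs.
    [Zs E b [::]] is the partition function divided by the number of configurations. *)
Definition Zs E b l : R := av (fun s => spins R l s * expR (b * ising_energy R E s)).

Definition corr E b l : R := Zs E b l / Zs E b [::].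

Lemma expR_energy E b s :
  expR (b * ising_energy R E s) = \prod_(e in E) expR (b * edge_spin R e s).
Proof. by rewrite /ising_energy mulr_sumr expR_sum. Qed.

Lemma Zs_gt0 E b : 0 < Zs E b [::].
Proof. by apply: av_gt0 => s; rewrite spins_nil mul1r expR_gt0. Qed.

Lemma Zs_neq0 E b : Zs E b [::] != 0.
Proof. by rewrite gt_eqF ?Zs_gt0. Qed.

Lemma Zs_ge0 E b l : 0 <= b -> 0 <= Zs E b l.
Proof.
move=> b0; rewrite (_ : Zs E b l = av (fun s =>
  spins R l s * \prod_(e in E) expR (b * edge_spin R e s))).
  exact: gks1_exp.
by apply: eq_av => s; rewrite expR_energy.
Qed.

Lemma corr_ge0 E b l : 0 <= b -> 0 <= corr E b l.
Proof. by move=> b0; rewrite divr_ge0 ?Zs_ge0. Qed.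

Lemma corr_nil E b : corr E b [::] = 1.
Proof. by rewrite /corr divff ?Zs_neq0. Qed.

Lemma corrK E b l : corr E b l * Zs E b [::] = Zs E b l.
Proof. by rewrite /corr mulfVK ?Zs_neq0. Qed.

Lemma eq_Zs E b l l' : spins R l =1 spins R l' -> Zs E b l = Zs E b l'.
Proof. by move=> ll; apply: eq_av => s; rewrite ll. Qed.

Lemma eq_corr E b l l' : spins R l =1 spins R l' -> corr E b l = corr E b l'.
Proof. by move=> ll; rewrite /corr (eq_Zs _ _ ll). Qed.

Lemma corrC E b y z : corr E b [:: y; z] = corr E b [:: z; y].
Proof. by apply: eq_corr => s; rewrite !spinsE mulrC. Qed.

Lemma corr_refl E b y : corr E b [:: y; y] = 1.
Proof.
by rewrite -(corr_nil E b); apply: eq_corr => s; rewrite !spinsE spin_sq.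
Qed.

(** The global spin flip preserves the energy, since edges have two endpoints, and changes the sign
    of an odd product of spins. *)
Lemma Zs_odd E b l : simple_edges E -> odd (size l) -> Zs E b l = 0.
Proof.
move=> E2 lo; pose t : cfg := [ffun=> true].
have tl : spins R l t = -1.
  rewrite /spins (eq_bigr (fun=> -1)); last by move=> y _; rewrite /spin ffunE expr1.
  by rewrite big_const_seq count_predT -Monoid.iteropE -[LHS]signr_odd lo expr1.
have te e : e \in E -> edge_spin R e t = 1.
  move=> /E2 e2; rewrite /edge_spin (eq_bigr (fun=> -1)).
    by rewrite prodr_const e2 expr2 mulrNN mulr1.
  by move=> y _; rewrite /spin ffunE expr1.
have H : Zs E b l = - Zs E b l.
  rewrite {1}/Zs -(av_flip t) -avN; apply: eq_av => s.
  rewrite spins_flip tl mulN1r mulNr /ising_energy; congr (- (_ * expR (_ * _))).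
  by apply: eq_bigr => e eE; rewrite -!/(edge_spin R e _) edge_spin_flip te ?mul1r.
by lra.
Qed.

(** The second replica is written as [flipc s t], so that [t] is the product of the two. Given [t],
    the edge [e] has coupling [b * (1 + edge_spin R e t)], which is [2 * b] or 0. *)
Lemma replica E b l l' : Zs E b l * Zs E b l' =
  av (fun t => spins R l' t *
    av (fun s => spins R (l ++ l') s *
      \prod_(e in E) expR (b * edge_spin R e s * (1 + edge_spin R e t)))).
Proof.
transitivity (av (fun s => av (fun t =>
  (spins R l s * expR (b * ising_energy R E s)) *
  (spins R l' t * expR (b * ising_energy R E t))))).
  by rewrite /Zs -avZr; apply: eq_av => s; rewrite -avZ.
transitivity (av (fun s => av (fun t => spins R l' t * (spins R (l ++ l') s *
      \prod_(e in E) expR (b * edge_spin R e s * (1 + edge_spin R e t)))))).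
  apply: eq_av => s; rewrite -(av_flip s); apply: eq_av => t.
  rewrite spins_cat spins_flip !expR_energy.
  rewrite [LHS](_ : _ = spins R l' t * (spins R l s * spins R l' s *
    (\prod_(e in E) expR (b * edge_spin R e s) *
     \prod_(e in E) expR (b * edge_spin R e (flipc s t))))); last by ring.
  congr (_ * (_ * _)); rewrite -big_split; apply: eq_bigr => e _ /=.
  by rewrite -expRD edge_spin_flip; congr expR; ring.
by rewrite av_exchange; apply: eq_av => t; rewrite avZ.
Qed.

Lemma replica_ge0 E b l t : 0 <= b ->
  0 <= av (fun s => spins R l s *
      \prod_(e in E) expR (b * edge_spin R e s * (1 + edge_spin R e t))).
Proof.
move=> b0; pose c e := b * (1 + edge_spin R e t).
rewrite (eq_av (g := fun s => spins R l s *
    \prod_(e in E) expR (c e * edge_spin R e s))).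
  by apply: gks1_exp => e; rewrite /c mulr_ge0 //; case: (edge_spin_cases R e t) => ->; lra.
by move=> s; congr (_ * _); apply: eq_bigr => e _; congr expR; rewrite /c; ring.
Qed.

(** Ginibre's argument: in the replica form, the difference of the two sides carries the factor
    [1 - spins R l' t >= 0] in front of an average that is nonnegative by [replica_ge0]. *)
Lemma gks2 E b l l' : 0 <= b -> corr E b l * corr E b l' <= corr E b (l ++ l').
Proof.
move=> b0; rewrite /corr mulrACA -invfM ler_pdivrMr ?(mulr_gt0 (Zs_gt0 _ _) (Zs_gt0 _ _)) //.
rewrite [_ / _ * _]mulrA mulfVK ?Zs_neq0 // !replica cats0 -subr_ge0 -avB av_ge0 // => t.
rewrite -mulrBl mulr_ge0 ?replica_ge0 // spins_nil.
by case: (spins_cases R l' t) => ->; lra.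
Qed.

Lemma corr_trans E b y z u : 0 <= b ->
  corr E b [:: y; z] * corr E b [:: z; u] <= corr E b [:: y; u].
Proof.
move=> b0; apply: le_trans (gks2 _ _ _ b0) _; rewrite le_eqVlt; apply/orP; left.
apply/eqP/eq_corr => s; rewrite /= !spinsE.
by rewrite [spin R s z * _]mulrA spin_sq mul1r.
Qed.

Lemma Zs_setU1 E e b l : e \notin E ->
  Zs (e |: E) b l = ch b * Zs E b l + sh b * Zs E b (l ++ enum e).
Proof.
move=> eE; rewrite /Zs -!avZ -avD; apply: eq_av => s.
rewrite !expR_energy big_setU1 //= expR_edge spins_cat -edge_spinE; ring.
Qed.

(** After clearing denominators, the gain from the new edge is [sh b] times the covariance of [l]
    and [enum e], nonnegative by [gks2]. *)
Lemma corr_setU1 E e b l : 0 <= b -> corr E b l <= corr (e |: E) b l.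
Proof.
move=> b0; have [eE|eE] := boolP (e \in E).
  by rewrite (setUidPr _) // sub1set.
rewrite {2}/corr ler_pdivlMr ?Zs_gt0 // !Zs_setU1 //=.
rewrite -!(corrK _ _ (_ ++ _)) -(corrK _ _ l) -(corrK _ _ (enum e)).
have H : corr E b l * corr E b (enum e) <= corr E b (l ++ enum e) by exact: gks2.
have S : 0 <= sh b by exact: sh_ge0.
rewrite -subr_ge0.
rewrite [X in 0 <= X](_ : _ = sh b * (corr E b (l ++ enum e) -
   corr E b l * corr E b (enum e)) * Zs E b [::]); last by ring.
apply: mulr_ge0 (ltW (Zs_gt0 _ _)).
by apply: mulr_ge0; rewrite ?subr_ge0.
Qed.

Lemma corrS E E' b l : 0 <= b -> E \subset E' -> corr E b l <= corr E' b l.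
Proof.
move=> b0 sE; apply: (@set_ind_sub _ (fun D => corr E b l <= corr D b l) _ _ sE) => // e D _ _ _ H.
exact: le_trans H (corr_setU1 _ _ _ b0).
Qed.

Lemma Zs_nil_setU1 E e b : e \notin E ->
  Zs (e |: E) b [::] = Zs E b [::] * (ch b + sh b * corr E b (enum e)).
Proof. by move=> eE; rewrite Zs_setU1 //= -(corrK _ _ (enum _)); ring. Qed.

Lemma edge_factor_ge1 E e b : 0 <= b -> 1 <= ch b + sh b * corr E b (enum e).
Proof.
move=> b0; rewrite -[1]addr0 lerD ?ch_ge1 // mulr_ge0 ?sh_ge0 ?corr_ge0 //.
Qed.

Lemma ZsS E E' b : 0 <= b -> E \subset E' -> Zs E b [::] <= Zs E' b [::].
Proof.
move=> b0 sE; apply: (@set_ind_sub _ (fun D => Zs E b [::] <= Zs D b [::]) _ _ sE) => // e D _ _ eD H.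
apply: le_trans H _; rewrite Zs_nil_setU1 // ler_peMr ?edge_factor_ge1 //.
by rewrite ltW ?Zs_gt0.
Qed.

(** The set [D] grows from [A :&: B] to [A] edge by edge. Each new edge multiplies either side by
    [ch b + sh b * corr _ b (enum e)], taken in [D] on the left and in the larger [D :|: B] on the
    right, where [corrS] makes it larger. *)
Lemma Zs_supermodular (A B : {set {set V}}) b : 0 <= b ->
  Zs A b [::] * Zs B b [::] <= Zs (A :|: B) b [::] * Zs (A :&: B) b [::].
Proof.
move=> b0; suff H (D : {set {set V}}) : A :&: B \subset D -> D \subset A ->
    Zs D b [::] * Zs B b [::] <= Zs (D :|: B) b [::] * Zs (A :&: B) b [::].
  exact/H/subxx/subsetIl.
move=> sD DA; pose P D := Zs D b [::] * Zs B b [::] <= Zs (D :|: B) b [::] * Zs (A :&: B) b [::].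
apply: (@set_ind_sub _ P _ _ sD); rewrite /P; first by rewrite (setUidPr _) ?subsetIr // mulrC.
move=> e D1 ID /(subsetP DA) eA eD H.
have eB : e \notin B.
  by apply: contra eD => eB; rewrite (subsetP ID) // inE eA.
rewrite -setUA !Zs_nil_setU1 //; last by rewrite in_setU negb_or eD.
rewrite mulrAC [leRHS]mulrAC; apply: (ler_pM _ _ H).
- exact: mulr_ge0 (ltW (Zs_gt0 _ _)) (ltW (Zs_gt0 _ _)).
- exact: le_trans ler01 (edge_factor_ge1 _ _ b0).
by rewrite lerD2l ler_wpM2l ?sh_ge0 // corrS // subsetUl.
Qed.

(** The bound is [tanh b], the correlation across an isolated edge. With [m] the correlation after
    deletion of the edge, the difference has the sign of [(ch b ^+ 2 - sh b ^+ 2) * m]. *)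
Lemma corr_edge_ge E b y z : 0 <= b -> y != z -> [set y; z]%SET \in E ->
  sh b / ch b <= corr E b [:: y; z].
Proof.
move=> b0 yz eE; set e := [set y; z]%SET in eE.
have He D : corr D b [:: y; z] = corr D b (enum e).
  by apply: eq_corr => s; rewrite -edge_spinE edge_spin_pair // !spinsE.
rewrite -(setD1K eE); set D := E :\ e.
have eD : e \notin D by rewrite !inE eqxx.
rewrite /corr Zs_nil_setU1 // Zs_setU1 // -(corrK D b [:: y; z]).
rewrite ler_pdivrMr ?ch_gt0 // mulrAC ler_pdivlMr; last first.
  by rewrite mulr_gt0 ?Zs_gt0 // (lt_le_trans ltr01) ?edge_factor_ge1.
rewrite (@eq_Zs D b ([:: y; z] ++ enum e) [::]); last first.
  by move=> s; rewrite spins_cat -edge_spinE edge_spin_pair // !spinsE mulrACA !spin_sq mulr1.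
rewrite -He; have := corr_ge0 D [:: y; z] b0; set m := corr _ _ _ => m0.
have Z0 := Zs_gt0 D b; set Z := Zs _ _ _ in Z0 *.
rewrite -subr_ge0 [X in 0 <= X](_ : _ = (ch b ^+ 2 - sh b ^+ 2) * m * Z); last by ring.
by rewrite ch2_sub_sh2 mul1r mulr_ge0 // ltW.
Qed.

End Correlations.

(** * Cluster expansion of two replicas *)

Section ClusterWeights.
Variables (R : realType) (V : finType) (b : R).
Hypothesis b0 : 0 <= b.
Local Notation cfg := {ffun V -> bool}.
Local Notation Zb E l := (Zs E b l).
Local Notation cb E l := (corr E b l).
Implicit Types (s t : cfg) (x y z u v : V) (e T : {set V}) (l : seq V)
  (C E : {set {set V}}).

Definition filt T l := [seq y <- l | y \in T].

Definition aligned C t : R := \prod_(e in C) (edge_spin R e t == 1)%:R.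

Definition outer x C E := inner (~: vertex_cluster x C) E.

(** Here [expR (2 * b * edge_spin R e s) - 1] is the weight of opening an edge along which the
    product of the two replicas is constant; that constraint itself is [aligned]. *)
Definition cluster_av C l : R := av (fun s =>
  spins R l s * \prod_(e in C) (expR (2 * b * edge_spin R e s) - 1)).

Lemma filt_sub T l : {subset filt T l <= T}.
Proof. by move=> y; rewrite mem_filter => /andP[]. Qed.

Lemma spins_filt T l s : spins R l s = spins R (filt T l) s * spins R (filt (~: T) l) s.
Proof. exact: spins_filter. Qed.

Lemma filt_cat T l l' : filt T (l ++ l') = filt T l ++ filt T l'.
Proof. exact: filter_cat. Qed.

(* Two Ising replicas at inverse temperature b, expanded according to the
   cluster of x in the percolation of their double current. *)
Lemma replica_cluster x E l l' : simple_edges E ->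
  Zb E l * Zb E l' =
  \sum_(C in powerset E | edge_cluster x C == C)
    cluster_av C (filt (vertex_cluster x C) (l ++ l'))
    * av (fun t => spins R (filt (vertex_cluster x C) l') t * aligned C t)
    * (Zb (outer x C E) (filt (~: vertex_cluster x C) l)
       * Zb (outer x C E) (filt (~: vertex_cluster x C) l')).
Proof.
move=> E2; rewrite replica.
pose g t s e := (edge_spin R e t == 1)%:R * (expR (2 * b * edge_spin R e s) - 1).
have Hg e s t : expR (b * edge_spin R e s * (1 + edge_spin R e t)) = 1 + g t s e.
  rewrite /g; case: (edge_spin_cases R e t) => ->.
    by rewrite eqxx mul1r [RHS]addrC subrK; congr expR; ring.
  rewrite subrr mulr0 expR0 (_ : (-1 == 1 :> R) = false) ?mul0r ?addr0 //.
  by apply/negbTE; rewrite -subr_eq0; apply/eqP; lra.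
transitivity (av (fun t => av (fun s =>
   \sum_(C in powerset E | edge_cluster x C == C)
     (spins R l' t * spins R (l ++ l') s * \prod_(e in C) g t s e
      * \prod_(e in outer x C E) (1 + g t s e))))).
  apply: eq_av => t; rewrite -avZ; apply: eq_av => s.
  under eq_bigr do rewrite Hg.
  rewrite (cluster_expansion x _ E2) !mulr_sumr.
  by apply: eq_bigr => C _; rewrite !mulrA.
transitivity (\sum_(C in powerset E | edge_cluster x C == C)
  av (fun t => av (fun s => spins R l' t * spins R (l ++ l') s * \prod_(e in C) g t s e
      * \prod_(e in outer x C E) (1 + g t s e)))).
  by rewrite -av_sum; apply: eq_av => t; rewrite -av_sum.
apply: eq_bigr => C; rewrite powersetE => /andP[CE /eqP hC].
set S := vertex_cluster x C; set D := outer x C E.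
have CS e : e \in C -> e \subset S by move=> eC; exact: ecluster_vcluster hC eC.
have DS e : e \in D -> e \subset ~: S by rewrite inE => /andP[].
(* The product of the two outer factors is itself written in replica form, so that both sides are
   averages over [t] and [s]. Independence of the spins in [S] and in [~: S] is then used for [s] at
   fixed [t], and next for [t]. *)
rewrite replica -mulrA -filt_cat.
transitivity (av (fun t =>
  spins R (filt S l') t * aligned C t *
  (spins R (filt (~: S) l') t * (cluster_av C (filt S (l ++ l')) *
   av (fun s => spins R (filt (~: S) (l ++ l')) s *
     \prod_(e in D) expR (b * edge_spin R e s * (1 + edge_spin R e t))))))).
  apply: eq_av => t.
  transitivity (av (fun s => spins R l' t * aligned C t *
    ((spins R (filt S (l ++ l')) s * \prod_(e in C) (expR (2 * b * edge_spin R e s) - 1))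
     * (spins R (filt (~: S) (l ++ l')) s *
        \prod_(e in D) expR (b * edge_spin R e s * (1 + edge_spin R e t)))))).
    apply: eq_av => s; rewrite (spins_filt S (l ++ l')) /g big_split /=.
    rewrite [in RHS](eq_bigr _ (fun e _ => Hg e s t)).
    by rewrite -/(aligned C t); ring.
  rewrite avZ (spins_filt S l') (@av_indep _ _ S).
  - by rewrite -/(cluster_av _ _); ring.
  - apply: dependsM; first exact/depends_spins/filt_sub.
    exact: (depends_prod (fun _ r => expR (2 * b * r) - 1)).
  - apply: dependsM; first exact/depends_spins/filt_sub.
    exact: (depends_prod (fun e r => expR (b * r * (1 + edge_spin R e t)))).
rewrite (@av_indep _ _ S).
- rewrite [cluster_av _ _ * (_ * _)]mulrCA; congr (_ * _).
  by rewrite -avZ; apply: eq_av => t; ring.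
- apply: dependsM; first exact/depends_spins/filt_sub.
  exact: (depends_prod (fun _ r => (r == 1)%:R)).
- apply: dependsM; first exact/depends_spins/filt_sub.
  move=> t t' tt'; congr (_ * _); apply: eq_av => s; congr (_ * _).
  by apply: eq_bigr => e eD; rewrite (depends_edge R (DS e eD) tt').
Qed.

Lemma aligned_root x C t y : simple_edges C -> aligned C t != 0 ->
  y \in vertex_cluster x C -> t y = t x.
Proof.
move=> C2 /prodf_neq0 H yC; apply/eqP.
suff : y \in [set y | t y == t x] by rewrite inE.
have : connect (open_adj C) x y by move: yC; rewrite inE.
apply: connect_closed; rewrite ?inE //.
move=> a c; rewrite !inE => /eqP <- ac.
have := H _ ac.
have aNc : a != c.
  by apply/negP => /eqP ec; have := C2 _ ac; rewrite ec setUid cards1.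
rewrite pnatr_eq0 eqb0 negbK edge_spin_pair // /spin -signr_addb.
case: (t a); case: (t c) => //=; rewrite expr1 => /eqP h; exfalso; lra.
Qed.

(** When [C] is aligned, all spins of its cluster equal the spin at [x], and an even number of them
    multiply to 1. *)
Lemma av_aligned_even x C l : simple_edges C -> ~~ odd (size l) ->
  {subset l <= vertex_cluster x C} ->
  av (fun t => spins R l t * aligned C t) = av (aligned C).
Proof.
move=> C2 lo lC; apply: eq_av => t.
have [->|H] := eqVneq (aligned C t) 0; first by rewrite mulr0.
rewrite (_ : spins R l t = 1) ?mul1r //.
rewrite /spins big_seq (eq_bigr (fun=> spin R t x)) -?big_seq; last first.
  by move=> y /lC yC; rewrite /spin (aligned_root C2 H yC).
rewrite big_const_seq count_predT -Monoid.iteropE -[LHS]/(_ ^+ _).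
by rewrite -(odd_double_half (size l)) (negbTE lo) add0n -mul2n exprM expr2 spin_sq expr1n.
Qed.

Lemma av_aligned_ge0 C : 0 <= av (aligned C).
Proof. by apply: av_ge0 => t; apply: prodr_ge0 => e _; rewrite ler0n. Qed.

(** Each factor equals [(ch (2 * b) - 1) + sh (2 * b) * edge_spin R e s], with nonnegative
    coefficients. *)
Lemma cluster_av_ge0 C l : 0 <= cluster_av C l.
Proof.
rewrite /cluster_av (eq_av (g := fun s => spins R l s *
    \prod_(e <- enum C) ((ch (2 * b) - 1) + sh (2 * b) * edge_spin R e s))).
  by apply: av_spins_prod_ge0 => e; rewrite ?subr_ge0 ?ch_ge1 // sh_ge0 // mulr_ge0.
move=> s; rewrite big_enum; congr (_ * _); apply: eq_bigr => e _.
by rewrite expR_edge; ring.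
Qed.

(* The weight of the event that x and u lie in the common cluster C in the
   random current representation of corr [:: x; u]. *)
Definition pw E x u C : R :=
  if u \in vertex_cluster x C then
    cluster_av C [:: x; u] * av (aligned C) * (Zb (outer x C E) [::] / Zb E [::]) ^+ 2
  else 0.

Lemma pw_ge0 E x u C : 0 <= pw E x u C.
Proof.
rewrite /pw; case: ifP => // _; rewrite mulr_ge0 ?sqr_ge0 //.
by rewrite mulr_ge0 ?cluster_av_ge0 ?av_aligned_ge0.
Qed.

Lemma corr2_sum E l l' : cb E l * cb E l' = Zb E l * Zb E l' / Zb E [::] ^+ 2.
Proof. by rewrite /corr; field; rewrite Zs_neq0. Qed.

Lemma outer_simple E x C : simple_edges E -> simple_edges (outer x C E).
Proof. exact/simple_sub/inner_sub. Qed.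

(** The second replica carries no spin. If [u] misses the cluster of [x], the outer graph carries
    the single spin at [u] and the term vanishes by [Zs_odd]. *)
Lemma corr_pw E x u : simple_edges E ->
  cb E [:: x; u] = \sum_(C in powerset E | edge_cluster x C == C) pw E x u C.
Proof.
move=> E2; rewrite -[LHS]mulr1 -(corr_nil E b) corr2_sum (replica_cluster x) //.
rewrite mulr_suml; apply: eq_bigr => C; rewrite powersetE => /andP[CE _].
have C2 := simple_sub CE E2; have D2 : simple_edges (outer x C E) by exact: outer_simple.
rewrite /pw /= mem_vcluster in_setC mem_vcluster /= in_setC.
case: ifP => uS /=; last by rewrite (@Zs_odd _ _ _ _ [:: u]) // mul0r mulr0 mul0r.
by rewrite (av_aligned_even (x := x)) // expr_div_n !expr2 !mulrA.
Qed.

(** A form of the switching lemma. Parity on the outer graph forces both [w] and [u] into the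
    cluster; the two spins at [w] then cancel, leaving the same weight as in [corr_pw]. *)
Lemma corr_corr_pw E x w u : simple_edges E ->
  cb E [:: x; w] * cb E [:: w; u] =
  \sum_(C in powerset E | edge_cluster x C == C)
     (w \in vertex_cluster x C)%:R * pw E x u C.
Proof.
move=> E2; rewrite corr2_sum (replica_cluster x) //.
rewrite mulr_suml; apply: eq_bigr => C; rewrite powersetE => /andP[CE _].
have C2 := simple_sub CE E2; have D2 : simple_edges (outer x C E) by exact: outer_simple.
rewrite /pw /= !in_setC !mem_vcluster /=.
case: (boolP (w \in _)) => wS /=; last first.
  by rewrite (@Zs_odd _ _ _ _ [:: w]) // !(mul0r, mulr0).
case: ifP => uS /=; last by rewrite (@Zs_odd _ _ _ _ [:: u]) // !(mul0r, mulr0).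
rewrite (av_aligned_even (x := x)) //; last first.
  by move=> y; rewrite !inE => /orP[/eqP->|/eqP->]; move: wS uS; rewrite !inE.
rewrite (_ : cluster_av C [:: x; w; w; u] = cluster_av C [:: x; u]).
  by rewrite mul1r expr_div_n !expr2 !mulrA.
by apply: eq_av => s; rewrite !spinsE [spin R s w * (_ * _)]mulrA spin_sq mul1r.
Qed.

Definition out_corr E x y v C : R :=
  ((y \notin vertex_cluster x C) && (v \notin vertex_cluster x C))%:R *
  cb (outer x C E) [:: y; v].

(** Both products have the same list [l ++ l'], hence the same [cluster_av]. Terms with [y] in the
    cluster cancel or vanish by parity; with [y] outside, parity leaves only the clusters containing
    exactly one of [u] and [v], and there only the first product survives. *)
Lemma cov_pw E x y u v : simple_edges E ->
  cb E [:: x; y; u; v] - cb E [:: x; y] * cb E [:: u; v] =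
  \sum_(C in powerset E | edge_cluster x C == C) pw E x u C * out_corr E x y v C +
  \sum_(C in powerset E | edge_cluster x C == C) pw E x v C * out_corr E x y u C.
Proof.
move=> E2; rewrite -[X in X - _]mulr1 -(corr_nil E b) !corr2_sum -mulrBl.
rewrite !(replica_cluster x) // -sumrB mulr_suml -big_split.
apply: eq_bigr => C; rewrite powersetE => /andP[CE _].
have C2 := simple_sub CE E2; have D2 : simple_edges (outer x C E) by exact: outer_simple.
rewrite /pw /out_corr /= !in_setC !mem_vcluster /=.
have Zn : Zb (outer x C E) [::] != 0 by exact: Zs_neq0.
have Zn' : Zb E [::] != 0 by exact: Zs_neq0.
have al : av (fun t => spins R [::] t * aligned C t) = av (aligned C).
  exact: (av_aligned_even (x := x)).
case: (boolP (y \in _)) => yS /=.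
  rewrite !mul0r !mulr0 addr0.
  case: (boolP (u \in _)) => uS /=; case: (boolP (v \in _)) => vS /=.
  - rewrite al (av_aligned_even (x := x)) // ?subrr ?mul0r //.
    by move=> z; rewrite !inE => /orP[/eqP->|/eqP->]; move: uS vS; rewrite !inE.
  - by rewrite !(@Zs_odd _ _ _ _ [:: v]) // !(mul0r, mulr0, subrr).
  - by rewrite !(@Zs_odd _ _ _ _ [:: u]) // !(mul0r, mulr0, subrr).
  - by rewrite al [X in X / _](_ : _ = 0) ?mul0r //; ring.
case: (boolP (u \in _)) => uS /=; case: (boolP (v \in _)) => vS /=.
- by rewrite !(@Zs_odd _ _ _ _ [:: y]) // !(mul0r, mulr0, subrr, addr0).
- rewrite (@Zs_odd _ _ _ _ [:: v]) // al !(mul0r, mulr0, subr0, addr0) mul1r.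
  by rewrite /corr; field; rewrite Zn.
- rewrite (@Zs_odd _ _ _ _ [:: u]) // al !(mul0r, mulr0, subr0, add0r) mul1r.
  by rewrite /corr; field; rewrite Zn.
- by rewrite !(@Zs_odd _ _ _ _ [:: y; u; v]) ?(@Zs_odd _ _ _ _ [:: y]) // !(mul0r, mulr0, subrr, addr0).
Qed.

End ClusterWeights.

(** * Derivatives in the inverse temperature *)

Section DerivativeRules.
Variables (R : realType).
Implicit Types (f g : R -> R) (a b x : R).

Lemma is_derive_mul f g x df dg : is_derive x 1 f df -> is_derive x 1 g dg ->
  is_derive x 1 (fun s => f s * g s) (df * g x + f x * dg).
Proof.
move=> hf hg; apply: (@is_derive_eq _ _ _ (f * g)).
by rewrite -!/(_ * _) /GRing.scale /= addrC [g x * _]mulrC.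
Qed.

Lemma is_derive_add f g x df dg : is_derive x 1 f df -> is_derive x 1 g dg ->
  is_derive x 1 (fun s => f s + g s) (df + dg).
Proof. by move=> hf hg; apply: (@is_deriveD _ _ _ f g). Qed.

Lemma is_derive_sub f g x df dg : is_derive x 1 f df -> is_derive x 1 g dg ->
  is_derive x 1 (fun s => f s - g s) (df - dg).
Proof. by move=> hf hg; apply: (@is_deriveB _ _ _ f g). Qed.

Lemma is_derive_scale f (c : R) x df : is_derive x 1 f df ->
  is_derive x 1 (fun s => c * f s) (c * df).
Proof. by move=> hf; apply: (@is_deriveZ _ _ _ f c). Qed.

Lemma is_derive_bigsum (I : Type) (r : seq I) (P : pred I) (F : I -> R -> R)
    (dF : I -> R) x :
  (forall i, P i -> is_derive x 1 (F i) (dF i)) ->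
  is_derive x 1 (fun s => \sum_(i <- r | P i) F i s) (\sum_(i <- r | P i) dF i).
Proof.
move=> hF; elim: r => [|i r IH].
  rewrite big_nil (_ : (fun s => _) = cst 0); first exact: is_derive_cst.
  by apply/funext => s; rewrite big_nil.
rewrite big_cons (_ : (fun s => _) = (fun s => (if P i then F i s else 0) +
    \sum_(j <- r | P j) F j s)); last first.
  by apply/funext => s; rewrite big_cons; case: ifP; rewrite ?add0r.
case: ifP => Pi; first by apply: is_derive_add => //; apply: hF.
by rewrite -[X in is_derive _ _ _ X]add0r; apply: is_derive_add => //; exact: is_derive_cst.
Qed.

Lemma is_derive_expRM (c : R) x :
  is_derive x 1 (fun s => expR (s * c)) (expR (x * c) * c).
Proof.
apply: (@is_derive1_comp _ expR (fun s => s * c)).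
have := @is_derive_mul id (cst c) x 1 0 (is_derive_id _ _) (is_derive_cst _ _ _).
by move/is_derive_eq; apply; rewrite mul1r mulr0 addr0.
Qed.

Lemma is_derive_lnf f x df : 0 < f x -> is_derive x 1 f df ->
  is_derive x 1 (fun s => ln (f s)) (df / f x).
Proof.
move=> fx hf; rewrite mulrC.
by apply: (@is_derive1_comp _ (@ln R) f) => //; exact: is_derive1_ln.
Qed.

Lemma is_derive_inv f x df : f x != 0 -> is_derive x 1 f df ->
  is_derive x 1 (fun s => (f s)^-1) (- df / f x ^+ 2).
Proof.
move=> fx hf; apply: (is_derive_eq (is_deriveV fx hf)).
by rewrite /GRing.scale /= mulNr mulrC mulNr.
Qed.

Lemma is_derive_div f g x df dg : g x != 0 ->
  is_derive x 1 f df -> is_derive x 1 g dg ->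
  is_derive x 1 (fun s => f s / g s) (df / g x - f x * dg / g x ^+ 2).
Proof.
move=> gx hf hg; apply: (is_derive_eq (is_derive_mul hf (is_derive_inv gx hg))).
by field.
Qed.

Lemma mvt f df a b : a < b ->
  (forall x, a <= x <= b -> is_derive x 1 f (df x)) ->
  exists2 c, a <= c <= b & f b - f a = df c * (b - a).
Proof.
move=> ab hf; have [x xab||c] := @MVT R f df a b ab.
- by apply: hf; move: xab; rewrite in_itv /= => /andP[/ltW -> /ltW ->].
- apply: derivable_within_continuous => x; rewrite in_itv /= => xab.
  by case: (hf x xab).
by rewrite in_itv /= => /andP[/ltW ac /ltW cb] ->; exists c; rewrite ?ac.
Qed.

Lemma derive_ge0_le f df a b : a <= b ->
  (forall x, a <= x <= b -> is_derive x 1 f (df x)) ->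
  (forall x, a <= x <= b -> 0 <= df x) -> f a <= f b.
Proof.
rewrite le_eqVlt => /predU1P[-> //|ab] hf df0.
have [c cab] := mvt ab hf; rewrite -subr_ge0 => ->.
by rewrite mulr_ge0 ?df0 // subr_ge0 ltW.
Qed.

(** The mean value theorem is applied to [f] and then to [df], which gives the constant [M] in place
    of the sharp [M / 2]. *)
Lemma taylor2_ge f df ddf (M : R) a b : a < b -> 0 <= M ->
  (forall x, a <= x <= b -> is_derive x 1 f (df x)) ->
  (forall x, a <= x <= b -> is_derive x 1 df (ddf x)) ->
  (forall x, a <= x <= b -> - M <= ddf x) ->
  df a * (b - a) - M * (b - a) ^+ 2 <= f b - f a.
Proof.
move=> ab M0 hf hdf hM; have [c /andP[ac cb] ->] := mvt ab hf.
have ba0 : 0 <= b - a by rewrite subr_ge0 ltW.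
have H : df a - M * (b - a) <= df c.
  move: ac; rewrite le_eqVlt => /predU1P[<-|ac].
    by rewrite lerBlDr lerDl mulr_ge0.
  have hdf' x : a <= x <= c -> is_derive x 1 df (ddf x).
    by case/andP=> ax xc; apply: hdf; rewrite ax (le_trans xc cb).
  have [d /andP[ad dc]] := mvt ac hdf'.
  have : - M <= ddf d by apply: hM; rewrite ad (le_trans dc cb).
  by move=> h1 h2; nra.
by rewrite expr2 mulrA -mulrBl ler_wpM2r.
Qed.

End DerivativeRules.

(** * Derivatives of partition functions and correlations *)

Section TemperatureDerivatives.
Variables (R : realType) (V : finType).
Implicit Types (E : {set {set V}}) (l : seq V) (b : R).

Lemma Zs_derive E l b : is_derive b 1 (fun s => Zs E s l)
  (\sum_(e in E) Zs E b (l ++ enum e)).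
Proof.
rewrite (_ : \sum_(e in E) _ = #|{: {ffun V -> bool}}|%:R^-1 *
   \sum_s spins R l s * (expR (b * ising_energy R E s) * ising_energy R E s)).
  apply: is_derive_scale; apply: is_derive_bigsum => s _.
  by apply: is_derive_scale; exact: is_derive_expRM.
rewrite -av_sum; apply: eq_av => s; rewrite /ising_energy !mulr_sumr.
by apply: eq_bigr => e _; rewrite spins_cat -edge_spinE /edge_spin; ring.
Qed.

Definition cov E b l l' : R := corr E b (l ++ l') - corr E b l * corr E b l'.

Lemma corr_derive E l b : is_derive b 1 (fun s => corr E s l)
  (\sum_(e in E) cov E b l (enum e)).
Proof.
have := @is_derive_div _ _ (fun s => Zs E s [::]) _ _ _ (Zs_neq0 E b)
  (Zs_derive E l b) (Zs_derive E [::] b).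
move/is_derive_eq; apply.
rewrite mulr_suml mulr_sumr mulr_suml -sumrB; apply: eq_bigr => e _.
by rewrite /cov /corr /=; field; rewrite Zs_neq0.
Qed.

Lemma corr_le_beta E l b b' : 0 <= b -> b <= b' -> corr E b l <= corr E b' l.
Proof.
move=> b0 bb; apply: (@derive_ge0_le _ (fun s => corr E s l)
  (fun s => \sum_(e in E) cov E s l (enum e)) _ _ bb) => [x _|x /andP[bx _]].
  exact: corr_derive.
by apply: sumr_ge0 => e _; rewrite subr_ge0 gks2 // (le_trans b0).
Qed.

Definition mean_energy E b : R := \sum_(e in E) corr E b (enum e).

Definition var_energy E b : R :=
  \sum_(e in E) \sum_(f in E) cov E b (enum e) (enum f).

Lemma lnZs_derive E b :
  is_derive b 1 (fun s => ln (Zs E s [::])) (mean_energy E b).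
Proof.
have := @is_derive_lnf _ (fun s => Zs E s [::]) _ _ (Zs_gt0 E b) (Zs_derive E [::] b).
by rewrite mulr_suml.
Qed.

Lemma mean_energy_derive E b : is_derive b 1 (mean_energy E) (var_energy E b).
Proof. by apply: is_derive_bigsum => e _; exact: corr_derive. Qed.

End TemperatureDerivatives.

(** * Removal of a vertex *)

Section VertexDeletion.
Variables (R : realType) (V : finType) (b : R).
Hypothesis b0 : 0 <= b.
Local Notation Zb E l := (Zs E b l).
Local Notation cb E l := (corr E b l).
Implicit Types (x y z u v w : V) (e T : {set V}) (l : seq V) (C E : {set {set V}}).

Definition delv w E := inner (~: [set w]) E.

Lemma inner_comm T T' E : inner T (inner T' E) = inner T' (inner T E).
Proof. by rewrite !innerI setIC. Qed.

Lemma outer_delv w x C E : outer x C (delv w E) = delv w (outer x C E).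
Proof. exact: inner_comm. Qed.

(** Only the ratio of partition functions depends on the graph. It increases by [Zs_supermodular]
    for [outer x C E] and [delv w E], whose intersection is [outer x C (delv w E)] and whose union
    lies in [E]. *)
Lemma pw_delv w E x u C : w \notin vertex_cluster x C ->
  pw b E x u C <= pw b (delv w E) x u C.
Proof.
move=> wS; rewrite /pw; case: ifP => // _.
apply: ler_wpM2l; first by rewrite mulr_ge0 ?cluster_av_ge0 ?av_aligned_ge0.
rewrite ler_pXn2r ?nnegrE ?divr_ge0 ?(ltW (Zs_gt0 _ _)) //.
rewrite ler_pdivrMr ?Zs_gt0 // mulrAC ler_pdivlMr ?Zs_gt0 //.
apply: le_trans (Zs_supermodular _ _ b0) _; rewrite mulrC.
have -> : outer x C E :&: delv w E = outer x C (delv w E).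
  apply/setP => e; rewrite !inE.
  by case: (e \in E); rewrite ?andbF // !andTb andbC.
by rewrite ler_wpM2l ?(ltW (Zs_gt0 _ _)) // ZsS // subUset !inner_sub.
Qed.

Lemma cluster_delv w E x C : C \subset E -> edge_cluster x C = C ->
  w \notin vertex_cluster x C -> C \subset delv w E.
Proof.
move=> /subsetP CE hC wS; apply/subsetP => e eC; rewrite inE CE //=.
apply: subset_trans (ecluster_vcluster hC eC) _.
by rewrite subsetC sub1set in_setC.
Qed.

(** A cluster avoiding [w] is also a cluster of [delv w E], with a larger weight. The function [h]
    will be 1 or an outer correlation. *)
Lemma sum_pw_delv w E x u (h : {set {set V}} -> R) : (forall C, 0 <= h C) ->
  \sum_(C in powerset E | edge_cluster x C == C)
    (w \notin vertex_cluster x C)%:R * pw b E x u C * h C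
  <= \sum_(C in powerset (delv w E) | edge_cluster x C == C)
       pw b (delv w E) x u C * h C.
Proof.
move=> h0; rewrite big_mkcond [leRHS]big_mkcond; apply: ler_sum => C _.
rewrite !powersetE.
have P0 : 0 <= pw b (delv w E) x u C * h C by rewrite mulr_ge0 ?pw_ge0.
case: (boolP (C \subset E)) => /= CE; last by case: ifP.
case: eqP => /= hC; last by rewrite andbF.
case: (boolP (w \in _)) => wS /=; first by rewrite !mul0r; case: ifP.
by rewrite (cluster_delv CE hC wS) /= mul1r ler_wpM2r ?pw_delv.
Qed.

Lemma pw_split w E x u C :
  pw b E x u C = (w \in vertex_cluster x C)%:R * pw b E x u C
               + (w \notin vertex_cluster x C)%:R * pw b E x u C.
Proof. by case: (w \in _); rewrite /= ?mul0r ?mul1r ?addr0 ?add0r. Qed.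

(** The clusters of [y] containing [w] have total mass given by [corr_corr_pw]; the others are
    controlled by [sum_pw_delv]. *)
Lemma corr_delv w E y v : simple_edges E ->
  cb E [:: y; v] <= cb (delv w E) [:: y; v] + cb E [:: y; w] * cb E [:: w; v].
Proof.
move=> E2; have D2 := simple_sub (inner_sub (~: [set w]) E) E2.
rewrite corr_corr_pw // !corr_pw // addrC.
rewrite (eq_bigr _ (fun C _ => pw_split w E y v C)) big_split lerD2l /=.
have /= := @sum_pw_delv w E y v (fun=> 1) (fun=> ler01).
by under eq_bigr do rewrite mulr1; under [X in _ <= X]eq_bigr do rewrite mulr1.
Qed.

Lemma out_corr_ge0 E x y v C : 0 <= out_corr b E x y v C.
Proof. by rewrite mulr_ge0 ?ler0n ?corr_ge0. Qed.

Lemma out_corr_le E x y v C : out_corr b E x y v C <= cb E [:: y; v].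
Proof.
rewrite /out_corr; case: (_ && _); last by rewrite mul0r corr_ge0.
by rewrite mul1r corrS ?inner_sub.
Qed.

Lemma out_corr_delv w E x y v C : simple_edges E ->
  out_corr b E x y v C <=
  out_corr b (delv w E) x y v C + cb E [:: y; w] * cb E [:: w; v].
Proof.
move=> E2; rewrite /out_corr; case: (_ && _); last first.
  by rewrite !mul0r add0r mulr_ge0 ?corr_ge0.
rewrite !mul1r outer_delv; apply: le_trans (corr_delv w _ _ (outer_simple E2)) _.
by rewrite lerD2l ler_pM ?corr_ge0 ?corrS ?inner_sub.
Qed.

Lemma sum_pw_out_delv w E x y u v : simple_edges E ->
  \sum_(C in powerset E | edge_cluster x C == C) pw b E x u C * out_corr b E x y v C
  <= \sum_(C in powerset (delv w E) | edge_cluster x C == C)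
       pw b (delv w E) x u C * out_corr b (delv w E) x y v C
     + cb E [:: x; u] * (cb E [:: y; w] * cb E [:: w; v])
     + cb E [:: x; w] * cb E [:: w; u] * cb E [:: y; v].
Proof.
move=> E2.
(* If [w] is outside the cluster, [out_corr_delv] moves the outer correlation to the graph without
   [w] at the cost of the second term. If [w] is inside, the outer correlation is bounded by the
   full one, which gives the third term. *)
apply: (@le_trans _ _ (\sum_(C in powerset E | edge_cluster x C == C)
   ((w \notin vertex_cluster x C)%:R * pw b E x u C * out_corr b (delv w E) x y v C
    + pw b E x u C * (cb E [:: y; w] * cb E [:: w; v])
    + (w \in vertex_cluster x C)%:R * pw b E x u C * cb E [:: y; v]))).
  apply: ler_sum => C _.
  have P0 := pw_ge0 b0 E x u C.
  have cc0 : 0 <= cb E [:: y; w] * cb E [:: w; v] by rewrite mulr_ge0 ?corr_ge0.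
  case: (w \in _) => /=; rewrite ?mul0r ?mul1r ?add0r ?addr0.
    rewrite -[leLHS]add0r; apply: lerD; first by rewrite mulr_ge0.
    by rewrite ler_wpM2l ?out_corr_le.
  by rewrite -mulrDr ler_wpM2l ?out_corr_delv.
rewrite !big_split /= -!mulr_suml -corr_pw // -corr_corr_pw //.
by rewrite !lerD2r sum_pw_delv // => C; exact: out_corr_ge0.
Qed.

Lemma cov4_delv w E x y u v : simple_edges E ->
  cov E b [:: x; y] [:: u; v] - cov (delv w E) b [:: x; y] [:: u; v] <=
  (cb E [:: x; u] * (cb E [:: y; w] * cb E [:: w; v])
   + cb E [:: x; w] * cb E [:: w; u] * cb E [:: y; v])
  + (cb E [:: x; v] * (cb E [:: y; w] * cb E [:: w; u])
     + cb E [:: x; w] * cb E [:: w; v] * cb E [:: y; u]).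
Proof.
move=> E2; have D2 := simple_sub (inner_sub (~: [set w]) E) E2.
rewrite /cov /= !cov_pw //.
have := sum_pw_out_delv w x y u v E2; have := sum_pw_out_delv w x y v u E2.
by lra.
Qed.

(** In [cov_pw] the outer correlations are at most the full ones, and the remaining weights sum to
    two-point functions by [corr_pw]. *)
Lemma lebowitz E x y u v : simple_edges E ->
  cov E b [:: x; y] [:: u; v] <=
  cb E [:: x; u] * cb E [:: y; v] + cb E [:: x; v] * cb E [:: y; u].
Proof.
move=> E2; rewrite /cov /= cov_pw // [X in _ <= X * _ + _]corr_pw //.
rewrite [X in _ <= _ + X * _]corr_pw // !mulr_suml.
by apply: lerD; apply: ler_sum => C _; rewrite ler_wpM2l ?pw_ge0 ?out_corr_le.
Qed.

End VertexDeletion.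

(** * Increment of the energy variance *)

Section VarianceIncrement.
Variables (R : realType) (V : finType) (G : {set {set V}}) (bc b T : R) (Delta : nat).
Hypothesis G2 : simple_edges G.
Hypothesis degG : forall y, (#|[set e in G | y \in e]| <= Delta)%N.
Hypothesis b0 : 0 <= b.
Hypothesis bbc : b <= bc.
Hypothesis bc0 : 0 < bc.
Local Notation m y z := (corr G bc [:: y; z]).
Hypothesis triG : forall w, \sum_y \sum_z m w y * m y z * m z w <= T.
Implicit Types (x y z u v w : V) (e f : {set V}) (S : {set V}) (E : {set {set V}}).

Let bc0' : 0 <= bc. Proof. exact: ltW. Qed.

Let m0 y z : 0 <= m y z. Proof. exact: corr_ge0. Qed.

Let tri0 w x u : 0 <= m w x * m x u * m u w.
Proof. exact: mulr_ge0 (mulr_ge0 (m0 _ _) (m0 _ _)) (m0 _ _). Qed.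

(** The inverse of the lower bound of [corr_edge_ge]: the price, in [corr_neighbour], of moving an
    endpoint of a two-point function across an edge. *)
Definition cothc := ch bc / sh bc.

Lemma cothc_ge1 : 1 <= cothc.
Proof.
rewrite /cothc ler_pdivlMr ?sh_gt0 // mul1r /ch /sh ler_pM2r ?invr_gt0 ?ltr0n //.
by rewrite lerD2l; apply: le_trans (expR_ge0 _); rewrite oppr_le0 expR_ge0.
Qed.

Let k0 : 0 <= cothc. Proof. exact: le_trans ler01 cothc_ge1. Qed.

Lemma corr_le_G E l : E \subset G -> corr E b l <= corr G bc l.
Proof. by move=> EG; apply: le_trans (corr_le_beta _ _ b0 bbc) (corrS _ bc0' EG). Qed.

Lemma corr_neighbour e x y v : e \in G -> x \in e -> y \in e ->
  m y v <= cothc * m x v.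
Proof.
move=> eG xe ye; have [->|yx] := eqVneq y x; first by rewrite ler_peMl ?cothc_ge1.
have ee : [set x; y]%SET = e.
  apply/eqP; rewrite eqEcard subUset !sub1set xe ye /= (G2 eG) cards2.
  by rewrite eq_sym yx.
have h1 := corr_trans G x y v bc0'.
have h2 : sh bc / ch bc <= m x y by apply: corr_edge_ge; rewrite ?ee // eq_sym.
have h3 : sh bc / ch bc * m y v <= m x v by apply: le_trans h1; rewrite ler_wpM2r.
rewrite /cothc mulrAC ler_pdivlMr ?sh_gt0 // mulrC [X in _ <= X]mulrC.
by move: h3; rewrite mulrAC ler_pdivrMr ?ch_gt0.
Qed.

Lemma edge_pair e x : e \in G -> x \in e ->
  exists y, [/\ y \in e, x != y & spins R (enum e) =1 spins R [:: x; y]].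
Proof.
move=> eG xe; have /eqP/cards2P[a [c [ac ee]]] := G2 eG.
have sp s : spins R (enum e) s = spin R s a * spin R s c.
  by rewrite -edge_spinE ee edge_spin_pair.
move: xe; rewrite ee !inE => /orP[/eqP->|/eqP->].
  by exists c; split; rewrite ?set22 // => s; rewrite -ee sp !spinsE.
by exists a; split; rewrite ?set21 1?eq_sym // => s; rewrite -ee sp !spinsE mulrC.
Qed.

Lemma eq_cov E l1 l1' l2 l2' : spins R l1 =1 spins R l1' ->
  spins R l2 =1 spins R l2' -> cov E b l1 l2 = cov E b l1' l2'.
Proof.
move=> h1 h2; rewrite /cov (eq_corr _ _ h1) (eq_corr _ _ h2).
by congr (_ - _); apply: eq_corr => s; rewrite !spins_cat h1 h2.
Qed.

Lemma covC E l l' : cov E b l l' = cov E b l' l.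
Proof.
rewrite /cov mulrC; congr (_ - _); apply: eq_corr => s.
by rewrite !spins_cat mulrC.
Qed.

Lemma cov_edge_le E e f x u : E \subset G -> e \in E -> f \in E ->
  x \in e -> u \in f ->
  cov E b (enum e) (enum f) <= 2 * cothc ^+ 2 * m x u ^+ 2.
Proof.
move=> EG /(subsetP EG) eG /(subsetP EG) fG xe uf.
have [y [ye xy /(eq_cov E)He]] := edge_pair eG xe.
have [v [vf uv Hf]] := edge_pair fG uf.
rewrite (He _ _ Hf); apply: le_trans (lebowitz b0 _ _ _ _ (simple_sub EG G2)) _.
have yv : m y v <= cothc ^+ 2 * m x u.
  apply: le_trans (corr_neighbour _ eG xe ye) _; rewrite expr2 -mulrA ler_wpM2l //.
  by rewrite corrC [X in _ <= _ * X]corrC; apply: corr_neighbour fG uf vf.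
have xv : m x v <= cothc * m x u.
  by rewrite corrC [X in _ <= _ * X]corrC; apply: corr_neighbour fG uf vf.
have yu : m y u <= cothc * m x u by exact: corr_neighbour eG xe ye.
have h1 : corr E b [:: x; u] * corr E b [:: y; v] <= m x u * (cothc ^+ 2 * m x u).
  by apply: ler_pM; rewrite ?corr_ge0 ?corr_le_G // (le_trans (corr_le_G _ EG)).
have h2 : corr E b [:: x; v] * corr E b [:: y; u] <= (cothc * m x u) * (cothc * m x u).
  apply: ler_pM; rewrite ?corr_ge0 //; first exact: le_trans (corr_le_G _ EG) xv.
  exact: le_trans (corr_le_G _ EG) yu.
apply: le_trans (lerD h1 h2) _; rewrite le_eqVlt; apply/orP; left; apply/eqP; ring.
Qed.

(** Each of the four terms of [cov4_delv] becomes the triangle through [w], [x], [u] after moving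
    [y] to [x] and [v] to [u], each move costing a factor [cothc]. *)
Lemma cov_edge_delv E w e f x u : E \subset G -> e \in E -> f \in E ->
  x \in e -> u \in f ->
  cov E b (enum e) (enum f) - cov (delv w E) b (enum e) (enum f)
  <= 4 * cothc ^+ 2 * (m w x * m x u * m u w).
Proof.
move=> EG /(subsetP EG) eG /(subsetP EG) fG xe uf.
have [y [ye xy He]] := edge_pair eG xe.
have [v [vf uv Hf]] := edge_pair fG uf.
rewrite !(eq_cov _ He Hf).
apply: le_trans (cov4_delv b0 w _ _ _ _ (simple_sub EG G2)) _.
have xv z : m z v <= cothc * m z u.
  by rewrite corrC [X in _ <= _ * X]corrC; apply: corr_neighbour fG uf vf.
have yu z : m y z <= cothc * m x z by exact: corr_neighbour eG xe ye.
have yv : m y v <= cothc * (cothc * m x u).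
  by apply: le_trans (yu v) _; rewrite ler_wpM2l.
have le3 a a' c c' d d' : 0 <= corr E b a -> 0 <= corr E b c -> 0 <= corr E b d ->
   corr E b a <= a' -> corr E b c <= c' -> corr E b d <= d' ->
   corr E b a * corr E b c * corr E b d <= a' * c' * d'.
  move=> a0 c0 d0 ha hc hd.
  exact: ler_pM (mulr_ge0 a0 c0) d0 (ler_pM a0 c0 ha hc) hd.
have c0 l : 0 <= corr E b l by exact: corr_ge0.
have cG l r : corr G bc l <= r -> corr E b l <= r by exact/le_trans/corr_le_G.
have h1 := le3 _ _ _ _ _ _ (c0 _) (c0 _) (c0 _)
  (cG [:: x; u] _ (lexx _)) (cG _ _ (yu w)) (cG _ _ (xv w)).
have h2 := le3 _ _ _ _ _ _ (c0 _) (c0 _) (c0 _)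
  (cG [:: x; w] _ (lexx _)) (cG [:: w; u] _ (lexx _)) (cG _ _ yv).
have h3 := le3 _ _ _ _ _ _ (c0 _) (c0 _) (c0 _)
  (cG _ _ (xv x)) (cG _ _ (yu w)) (cG [:: w; u] _ (lexx _)).
have h4 := le3 _ _ _ _ _ _ (c0 _) (c0 _) (c0 _)
  (cG [:: x; w] _ (lexx _)) (cG _ _ (xv w)) (cG _ _ (yu u)).
rewrite [corr E b [:: x; u] * (_ * _)]mulrA [corr E b [:: x; v] * (_ * _)]mulrA.
rewrite (corrC G bc u w) (corrC G bc w x).
apply: le_trans (lerD (lerD h1 h2) (lerD h3 h4)) _.
by rewrite le_eqVlt; apply/orP; left; apply/eqP; ring.
Qed.

(** Each edge is charged to its endpoints, and a vertex receives at most [Delta] charges. *)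
Lemma sum_edges_le E (F : {set V} -> R) (t : V -> R) : E \subset G ->
  (forall x, 0 <= t x) -> (forall e x, e \in E -> x \in e -> F e <= t x) ->
  \sum_(e in E) F e <= Delta%:R * \sum_x t x.
Proof.
move=> EG t0 Ft.
apply: (@le_trans _ _ (\sum_(e in E) \sum_(x in e) t x)).
  apply: ler_sum => e eE.
  have /card_gt0P[x xe] : (0 < #|e|)%N by rewrite (G2 (subsetP EG _ eE)).
  apply: le_trans (Ft _ _ eE xe) _; rewrite (bigD1 x) //= lerDl.
  by apply: sumr_ge0.
rewrite (exchange_big_dep predT) //= mulr_sumr; apply: ler_sum => x _.
rewrite sumr_const -[X in X <= _]mulr_natl ler_wpM2r // ler_nat.
apply: leq_trans (degG x); apply/subset_leq_card/subsetP => e.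
by rewrite !inE => /andP[/(subsetP EG) -> ->].
Qed.

(** The bubble consists of the terms [z = u] of the triangle, as [m u u = 1]. *)
Lemma bubble_le w : \sum_u m w u ^+ 2 <= T.
Proof.
apply: le_trans (triG w); apply: ler_sum => u _.
rewrite (bigD1 u) //= corr_refl mulr1 (corrC G bc u w) -expr2 lerDl.
by apply: sumr_ge0 => z _; exact: tri0.
Qed.

(** The constant is 8 = 4 + 2 + 2: pairs of edges both avoiding [w] give 4, and the pairs with an
    edge at [w] give 2 for each of two sums. *)
Definition var_const : R := 8 * (Delta%:R * cothc) ^+ 2.

Lemma var_energy_delv w E : E \subset G ->
  var_energy E b - var_energy (delv w E) b <= var_const * T.
Proof.
move=> EG; set D := delv w E; have DE : D \subset E := inner_sub _ _.
have DG := subset_trans DE EG.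
have inw e : e \in E :\: D -> w \in e.
  by rewrite !inE => /andP[+ eE]; rewrite eE /= subsetC sub1set in_setC negbK.
have K2 : 0 <= 2 * cothc ^+ 2 by rewrite mulr_ge0 ?sqr_ge0.
have K4 : 0 <= 4 * cothc ^+ 2 by rewrite mulr_ge0 ?sqr_ge0.
have D0 : 0 <= Delta%:R :> R by exact: ler0n.
(* Pairs with an edge at [w] have no counterpart after the deletion; their whole covariance is
   bounded by the bubble at [w]. *)
have BE (A : {set {set V}}) : A \subset E -> \sum_(e in E :\: D) \sum_(f in A) cov E b (enum e) (enum f)
     <= 2 * (Delta%:R * cothc) ^+ 2 * T.
  move=> AE.
  have H e : e \in E :\: D -> \sum_(f in A) cov E b (enum e) (enum f)
      <= Delta%:R * (2 * cothc ^+ 2 * T).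
    move=> eB; have eE : e \in E by move: eB; rewrite inE => /andP[].
    have h1 u : 0 <= 2 * cothc ^+ 2 * m w u ^+ 2 by rewrite mulr_ge0 ?sqr_ge0.
    have h2 f u : f \in A -> u \in f ->
        cov E b (enum e) (enum f) <= 2 * cothc ^+ 2 * m w u ^+ 2.
      by move=> fA uf; apply: cov_edge_le => //; [exact: (subsetP AE)|exact: inw].
    apply: le_trans (sum_edges_le (subset_trans AE EG) h1 h2) _.
    rewrite -mulr_sumr ler_wpM2l //. rewrite ler_wpM2l //. exact: bubble_le.
  apply: le_trans (ler_sum _ H) _; rewrite sumr_const -[X in X <= _]mulr_natl.
  have T0 : 0 <= T by apply: le_trans (bubble_le w); apply: sumr_ge0 => u _; exact: sqr_ge0.
  rewrite [leRHS](_ : _ = Delta%:R * (Delta%:R * (2 * cothc ^+ 2 * T))); last by ring.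
  rewrite ler_wpM2r ?(mulr_ge0 D0 (mulr_ge0 K2 T0)) // ler_nat.
  apply: leq_trans (degG w); apply/subset_leq_card/subsetP => e eB.
  rewrite inE inw // andbT; apply: (subsetP EG).
  by move: eB; rewrite inE => /andP[].
have DD : \sum_(e in D) \sum_(f in D)
    (cov E b (enum e) (enum f) - cov D b (enum e) (enum f))
    <= 4 * (Delta%:R * cothc) ^+ 2 * T.
  have h1 x u : 0 <= 4 * cothc ^+ 2 * (m w x * m x u * m u w) by exact: mulr_ge0.
  have h2 e x : e \in D -> x \in e ->
      \sum_(f in D) (cov E b (enum e) (enum f) - cov D b (enum e) (enum f))
      <= Delta%:R * \sum_u 4 * cothc ^+ 2 * (m w x * m x u * m u w).
    move=> eD xe; apply: (sum_edges_le DG (h1 x)) => f u fD uf.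
    by apply: cov_edge_delv => //; exact: (subsetP DE).
  have h3 x : 0 <= Delta%:R * \sum_u 4 * cothc ^+ 2 * (m w x * m x u * m u w).
    by apply: mulr_ge0 => //; apply: sumr_ge0 => u _.
  apply: le_trans (sum_edges_le DG h3 h2) _.
  rewrite -mulr_sumr; under eq_bigr do rewrite -mulr_sumr.
  rewrite -mulr_sumr.
  rewrite [leRHS](_ : _ = Delta%:R * (Delta%:R * (4 * cothc ^+ 2 * T))); last by ring.
  by do 3 (rewrite ler_wpM2l //).
have split F : \sum_(e in E) F e
   = \sum_(e in D) F e + \sum_(e in E :\: D) F e :> R.
  by rewrite (big_setID D) /= (setIidPr DE).
have B1 := BE E (subxx _); have := BE D DE; rewrite exchange_big /= => B2.
have C2 : \sum_(e in D) \sum_(f in E :\: D) cov E b (enum e) (enum f)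
     <= 2 * (Delta%:R * cothc) ^+ 2 * T.
  by apply: le_trans B2; apply: ler_sum => e _; apply: ler_sum => f _; rewrite covC.
rewrite /var_energy split (eq_bigr _ (fun e _ => split _)) big_split /=.
have : \sum_(e in D) \sum_(f in D) cov E b (enum e) (enum f)
    - \sum_(e in D) \sum_(f in D) cov D b (enum e) (enum f)
    <= 4 * (Delta%:R * cothc) ^+ 2 * T.
  by rewrite -sumrB; under eq_bigr do rewrite -sumrB.
rewrite /var_const; lra.
Qed.

Lemma var_energy_inner S E : E \subset G ->
  var_energy E b - var_energy (inner (~: S) E) b <= var_const * T * #|S|%:R.
Proof.
move=> EG.
pose P (D : {set V}) := var_energy E b - var_energy (inner (~: D) E) b
  <= var_const * T * #|D|%:R.
apply: (@set_ind_sub _ P _ _ (sub0set S)); rewrite /P.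
  rewrite cards0 mulr0 (_ : inner _ E = E) ?subrr //.
  by apply/setP => e; rewrite !inE setC0 subsetT andbT.
move=> w D _ _ wD H.
have -> : inner (~: (w |: D)) E = delv w (inner (~: D) E).
  by rewrite /delv innerI setCU.
rewrite cardsU1 wD natrD mulrDr mulr1.
have := var_energy_delv w (subset_trans (inner_sub (~: D) E) EG); lra.
Qed.

End VarianceIncrement.

(** * Law of the edge cluster *)

Section ClusterLaw.
Variables (R : realType) (V : finType) (o : V) (E : {set {set V}}).
Hypothesis E2 : simple_edges E.
Local Notation cfg := {ffun V -> bool}.
Local Notation r s := (expR (s * 2) - 1).
Implicit Types (C w : {set {set V}}) (e : {set V}) (s : R).

Lemma aligned01 w (t : cfg) :
  aligned R w t = if [forall e in w, edge_spin R e t == 1] then 1 else 0.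
Proof.
rewrite /aligned; case: ifPn => [/forallP H|].
  by rewrite big1 // => e ew; have /implyP/(_ ew) -> := H e.
rewrite negb_forall => /existsP[e]; rewrite negb_imply => /andP[ew /negbTE he].
by rewrite (bigD1 e) //= he mul0r.
Qed.

(* A spin configuration constant on the clusters of w is determined by the set
   of roots of clusters where it is true. *)
Lemma nb_clusters_spins w : simple_edges w ->
  2 ^+ nb_clusters w = #|{: cfg}|%:R * av (aligned R w).
Proof.
move=> w2; rewrite /av mulVKf ?card_cfg_neq0 //.
have sym : connect_sym (open_adj w).
  by apply: sym_connect_sym => y z; rewrite /open_adj setUC.
pose rt := fingraph.root (open_adj w).
pose P := [set t : cfg | [forall e in w, edge_spin R e t == 1]]%SET.
pose Rt := [set y | rt y == y]%SET.
have tP (t : cfg) y : t \in P -> t (rt y) = t y.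
  rewrite inE => Pt; apply: (aligned_root (R := R) w2).
    by rewrite aligned01 Pt oner_neq0.
  by rewrite inE connect_root.
transitivity (#|P|%:R : R); last first.
  rewrite -sumr_const [LHS]big_mkcond; apply: eq_bigr => t _.
  by rewrite aligned01 inE.
suff <- : (2 ^ nb_clusters w)%N = #|P| by rewrite natrX.
rewrite (_ : nb_clusters w = #|Rt|); last first.
  by rewrite /nb_clusters /n_comp_mem; apply: eq_card => y; rewrite !inE andbT.
rewrite -card_powerset.
pose f (t : cfg) := [set y in Rt | t y]%SET.
have finj : {in P &, injective f}.
  move=> t t' tp tp' /setP ff; apply/ffunP => y.
  have := ff (rt y); rewrite !inE /rt (root_root sym) eqxx /=.
  by rewrite -!/(rt _) !tP.
rewrite -(card_in_imset finj); apply: eq_card => A.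
rewrite powersetE; apply/idP/imsetP => [AR|[t _ ->]]; last first.
  by apply/subsetP => y; rewrite inE => /andP[].
exists [ffun y => rt y \in A].
  rewrite inE; apply/forallP => e; apply/implyP => ew.
  have /eqP/cards2P[a [c [ac ee]]] := w2 _ ew.
  rewrite ee edge_spin_pair // /spin !ffunE.
  have -> : rt a = rt c.
    by apply/eqP; rewrite root_connect //; apply: connect1; rewrite /open_adj -ee.
  by rewrite -signr_addb addbb.
apply/setP => y; rewrite !inE ffunE.
have [yA|yA] := boolP (y \in A).
  by have := subsetP AR _ yA; rewrite inE => /eqP ry; rewrite ry eqxx.
by apply/esym/negbTE/negP => /andP[/eqP ->]; exact/negP.
Qed.

(** The Edwards-Sokal coupling: the factor 2 per cluster counts the spin configurations constant on
    clusters. *)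
Lemma fk_weight_spins s w : w \subset E ->
  fk_weight E s w = #|{: cfg}|%:R *
    av (fun t => \prod_(e in w) (r s * (edge_spin R e t == 1)%:R)).
Proof.
move=> wE; rewrite /fk_weight nb_clusters_spins; last exact: simple_sub wE E2.
rewrite -mulrA; congr (_ * _); rewrite mulrC -avZ; apply: eq_av => t.
rewrite big_split /=; congr (_ * _); rewrite mulrC.
rewrite [RHS]big_mkcond [LHS]big_mkcond; apply: eq_bigr => e _ /=.
case: (boolP (e \in w)) => [/(subsetP wE) -> //|_].
by case: ifP; rewrite ?expr0.
Qed.

Lemma expR_open s e (t : cfg) :
  1 + r s * (edge_spin R e t == 1)%:R = expR (s * (1 + edge_spin R e t)).
Proof.
case: (edge_spin_cases R e t) => ->.
  by rewrite eqxx mulr1 addrC subrK; congr expR; ring.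
rewrite (_ : (-1 == 1 :> R) = false); last first.
  by apply/negbTE; rewrite -subr_eq0; apply/eqP; lra.
by rewrite mulr0 addr0 subrr mulr0 expR0.
Qed.

Lemma av_prod_open s (D : {set {set V}}) :
  av (fun t => \prod_(e in D) (1 + r s * (edge_spin R e t == 1)%:R))
  = expR (s * #|D|%:R) * Zs D s [::].
Proof.
rewrite /Zs -avZ; apply: eq_av => t; rewrite spins_nil mul1r expR_energy.
have -> : expR (s * #|D|%:R) = \prod_(e in D) expR s.
  by rewrite prodr_const -expRM_natr.
by rewrite -big_split; apply: eq_bigr => e _; rewrite /= expR_open -expRD; congr expR; ring.
Qed.

Lemma fk_partition s : \sum_(w in powerset E) fk_weight E s w
  = #|{: cfg}|%:R * (expR (s * #|E|%:R) * Zs E s [::]).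
Proof.
rewrite -av_prod_open (eq_bigr _ (fun w (h : w \in powerset E) =>
  fk_weight_spins s (etrans (esym (powersetE _ _)) h))) -mulr_sumr.
by rewrite -av_sum; congr (_ * _); apply: eq_av => t; rewrite prod1D_powerset.
Qed.

Definition outer_excess C : R := #|outer o C E|%:R - #|E|%:R.

(* The probability pi_s(C) that the edge cluster of o is C. *)
Definition cluster_law s C : R :=
  av (aligned R C) * r s ^+ #|C| * expR (s * outer_excess C)
  * (Zs (outer o C E) s [::] / Zs E s [::]).

Lemma fk_weight_cluster s C : C \subset E -> edge_cluster o C = C ->
  \sum_(w in powerset E | edge_cluster o w == C) fk_weight E s w
  = cluster_law s C * \sum_(w in powerset E) fk_weight E s w.
Proof.
move=> CE hC; rewrite fk_partition.
transitivity (#|{: cfg}|%:R * \sum_(w in powerset E | edge_cluster o w == C)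
   av (fun t => \prod_(e in w) (r s * (edge_spin R e t == 1)%:R))).
  rewrite mulr_sumr; apply: eq_bigr => w /andP[]; rewrite powersetE => wE _.
  exact: fk_weight_spins.
rewrite [RHS]mulrCA; congr (_ * _); rewrite -av_sum.
transitivity (av (fun t => r s ^+ #|C| * aligned R C t *
   \prod_(e in outer o C E) (1 + r s * (edge_spin R e t == 1)%:R))).
  apply: eq_av => t; rewrite (sum_ecluster _ E2 CE hC); congr (_ * _).
  by rewrite big_split prodr_const.
rewrite (@av_indep _ _ (vertex_cluster o C)).
- rewrite av_prod_open avZ /cluster_law.
  have -> : expR (s * #|outer o C E|%:R) = expR (s * outer_excess C) * expR (s * #|E|%:R).
    by rewrite -expRD /outer_excess; congr expR; ring.
  have := Zs_neq0 E s; move: (Zs E s [::]) (r s ^+ #|C|) (av _) (Zs _ _ _).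
  by move=> z ? ? ? z0; field.
- move=> t t' tt'; congr (_ * _).
  apply: (depends_prod (fun _ u => (u == 1)%:R) _ tt') => e.
  exact: ecluster_vcluster.
- apply: (depends_prod (fun _ u => 1 + r s * (u == 1)%:R)) => e.
  by rewrite inE => /andP[].
Qed.

Lemma fk_partition_neq0 s : \sum_(w in powerset E) fk_weight E s w != 0.
Proof.
rewrite fk_partition; apply: mulf_neq0 (card_cfg_neq0 _ _) _.
by apply: mulf_neq0 (Zs_neq0 _ _); rewrite gt_eqF ?expR_gt0.
Qed.

Lemma fk_mean_cluster s (X : {set {set V}} -> R) :
  fk_mean E s (fun w => X (edge_cluster o w)) =
  \sum_(C in powerset E | edge_cluster o C == C) cluster_law s C * X C.
Proof.
rewrite /fk_mean /gibbs_mean.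
rewrite (partition_big (edge_cluster o)
  (fun C => (C \in powerset E) && (edge_cluster o C == C))) /=; last first.
  move=> w; rewrite !powersetE => wE.
  by rewrite ecluster_idem eqxx (subset_trans (ecluster_sub _ _) wE).
rewrite mulr_suml; apply: eq_bigr => C; rewrite powersetE => /andP[CE /eqP hC].
rewrite (eq_bigr (fun w => fk_weight E s w * X C)); last by move=> w /andP[_ /eqP->].
rewrite -mulr_suml fk_weight_cluster // mulrAC mulfK //.
exact: fk_partition_neq0.
Qed.

Lemma cluster_law_sum s :
  \sum_(C in powerset E | edge_cluster o C == C) cluster_law s C = 1.
Proof.
have := @fk_mean_cluster s (fun=> 1); rewrite /fk_mean /gibbs_mean.
under eq_bigr do rewrite mulr1.
rewrite divff ?fk_partition_neq0 // => ->.
by apply: eq_bigr => C _; rewrite mulr1.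
Qed.

(** Written factor by factor to make its derivatives explicit; [log_lawK] identifies it with the
    logarithm of [cluster_law] for [s > 0], where [r s > 0]. *)
Definition log_law C s : R :=
  ln (av (aligned R C)) + #|C|%:R * ln (r s) + s * outer_excess C
  + (ln (Zs (outer o C E) s [::]) - ln (Zs E s [::])).

Definition dlog_law C s : R :=
  #|C|%:R * (expR (s * 2) * 2 / r s) + outer_excess C
  + (mean_energy (outer o C E) s - mean_energy E s).

Definition ddlog_law C s : R :=
  #|C|%:R * (- (expR (s * 2) * 4) / r s ^+ 2)
  + (var_energy (outer o C E) s - var_energy E s).

Lemma r_gt0 s : 0 < s -> 0 < r s.
Proof. by move=> s0; rewrite subr_gt0 -[X in X < _]expR0 ltr_expR mulr_gt0. Qed.

Lemma av_aligned_gt0 C : simple_edges C -> 0 < av (aligned R C).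
Proof.
move=> C2; have : 0 < 2 ^+ nb_clusters C :> R by rewrite exprn_gt0.
rewrite nb_clusters_spins // pmulr_rgt0 //.
by rewrite lt_def card_cfg_neq0 ler0n.
Qed.

Lemma log_lawK C s : 0 < s -> C \subset E ->
  cluster_law s C = expR (log_law C s).
Proof.
move=> s0 CE; have C2 := simple_sub CE E2.
rewrite /log_law !expRD expRN !lnK ?posrE ?Zs_gt0 ?av_aligned_gt0 //.
by rewrite mulr_natl -lnXn ?r_gt0 // lnK // posrE exprn_gt0 // r_gt0.
Qed.

Lemma is_derive_r s : is_derive s 1 (fun u : R => r u) (expR (s * 2) * 2).
Proof.
have := is_derive_sub (is_derive_expRM 2 s) (@is_derive_cst _ _ _ (1 : R) s 1).
by move/is_derive_eq; apply; rewrite subr0.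
Qed.

Lemma is_derive_lin s (c : R) : is_derive s 1 (fun u : R => u * c) c.
Proof.
have := @is_derive_mul _ id (cst c) s 1 0 (is_derive_id _ _) (is_derive_cst _ _ _).
by move/is_derive_eq; apply; rewrite mul1r mulr0 addr0.
Qed.

Lemma log_law_derive C s : 0 < s -> is_derive s 1 (log_law C) (dlog_law C s).
Proof.
move=> s0; apply: is_derive_add; last by apply: is_derive_sub; exact: lnZs_derive.
apply: is_derive_add; last exact: is_derive_lin.
have := is_derive_add (@is_derive_cst _ _ _ (ln (av (aligned R C)) : R) s 1)
  (is_derive_scale #|C|%:R (@is_derive_lnf _ (fun u => r u) _ _ (r_gt0 s0) (is_derive_r s))).
by move/is_derive_eq; apply; rewrite add0r.
Qed.

Lemma dlog_law_derive C s : 0 < s -> is_derive s 1 (dlog_law C) (ddlog_law C s).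
Proof.
move=> s0; apply: is_derive_add; last by apply: is_derive_sub; exact: mean_energy_derive.
have rn0 : r s != 0 by rewrite gt_eqF ?r_gt0.
have h1 : is_derive s 1 (fun u : R => expR (u * 2) * 2) (expR (s * 2) * 4).
  have := is_derive_mul (is_derive_expRM 2 s) (@is_derive_cst _ _ _ (2 : R) s 1).
  by move/is_derive_eq; apply; rewrite /cst; ring.
have h2 := @is_derive_div _ _ (fun u => r u) _ _ _ rn0 h1 (is_derive_r s).
have := is_derive_add (is_derive_scale #|C|%:R h2)
  (@is_derive_cst _ _ _ (outer_excess C) s 1).
by move/is_derive_eq; apply; rewrite addr0; congr (_ * _); field.
Qed.

(** The left side is the derivative of the total mass, which is constantly 1. *)
Lemma dlog_law_mean s : 0 < s ->
  \sum_(C in powerset E | edge_cluster o C == C) cluster_law s C * dlog_law C s = 0.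
Proof.
move=> s0.
have h1 : is_derive s 1
    (fun u => \sum_(C in powerset E | edge_cluster o C == C) expR (log_law C u))
    (\sum_(C in powerset E | edge_cluster o C == C) cluster_law s C * dlog_law C s).
  apply: is_derive_bigsum => C; rewrite powersetE => /andP[CE _].
  rewrite log_lawK //.
  by apply: (@is_derive1_comp _ expR (log_law C)); exact: log_law_derive.
have h2 : is_derive s 1
    (fun u => \sum_(C in powerset E | edge_cluster o C == C) expR (log_law C u)) 0.
  pose F u := \sum_(C in powerset E | edge_cluster o C == C) expR (log_law C u).
  (* The exponential formula for the law is available only for positive [u], hence the local
     comparison with a constant near [s]. *)
  suff F1 : \forall u \near s, cst 1 u = F u.
    have := @near_eq_is_derive R R R (cst 1) F s 1 0 F1.
    by apply; exact: is_derive_cst.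
  near=> u; rewrite /cst -(cluster_law_sum u); apply: eq_bigr => C.
  rewrite powersetE => /andP[CE _]; apply: log_lawK => //.
  by near: u; exact: lt_nbhsr.
by rewrite -(@derive_val _ _ _ _ _ _ _ h1) (@derive_val _ _ _ _ _ _ _ h2).
Unshelve. all: by end_near.
Qed.

End ClusterLaw.

(** * Relative entropy *)

Section Hellinger.
Variables (R : realType) (I : finType).
Implicit Types (P B : pred I).

Lemma cauchy_schwarz_sum P (a c : I -> R) :
  (\sum_(i | P i) a i * c i) ^+ 2
  <= (\sum_(i | P i) a i ^+ 2) * (\sum_(i | P i) c i ^+ 2).
Proof.
have : 0 <= \sum_(i | P i) \sum_(j | P j) (a i * c j - a j * c i) ^+ 2.
  by apply: sumr_ge0 => i _; apply: sumr_ge0 => j _; exact: sqr_ge0.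
set A := \sum_(i | P i) a i ^+ 2; set D := \sum_(i | P i) c i ^+ 2.
set S := \sum_(i | P i) a i * c i.
have -> : \sum_(i | P i) \sum_(j | P j) (a i * c j - a j * c i) ^+ 2
    = A * D + D * A - 2 * (S * S).
  rewrite /A /D /S !mulr_suml mulr_sumr -big_split -sumrB; apply: eq_bigr => i _ /=.
  rewrite !mulr_sumr -big_split -sumrB; apply: eq_bigr => j _ /=; ring.
by lra.
Qed.

(* Relative entropy dominates the squared Hellinger distance
   sum (sqrt mu - sqrt nu)^2, and Cauchy-Schwarz is applied to
   mu - nu = (sqrt mu - sqrt nu) (sqrt mu + sqrt nu). *)
Lemma entropy_event P B (g g' : I -> R) :
  \sum_(i | P i) expR (g i) = \sum_(i | P i) expR (g' i) ->
  (\sum_(i | P i && B i) expR (g i) - \sum_(i | P i && B i) expR (g' i)) ^+ 2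
  <= 4 * Num.max (\sum_(i | P i && B i) expR (g i)) (\sum_(i | P i && B i) expR (g' i))
     * \sum_(i | P i) expR (g' i) * (g' i - g i).
Proof.
move=> Z.
pose h i := expR (g i / 2); pose h' i := expR (g' i / 2).
have hE i : expR (g i) = h i ^+ 2 by rewrite -expRM_natl; congr expR; field.
have hE' i : expR (g' i) = h' i ^+ 2 by rewrite -expRM_natl; congr expR; field.
set N := \sum_(i | P i && B i) expR (g i); set M := \sum_(i | P i && B i) expR (g' i).
have N0 : 0 <= N by apply: sumr_ge0 => i _; exact: expR_ge0.
have M0 : 0 <= M by apply: sumr_ge0 => i _; exact: expR_ge0.
pose H := \sum_(i | P i) (h i - h' i) ^+ 2.
have H0 : 0 <= H by apply: sumr_ge0 => i _; exact: sqr_ge0.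
(* Since the total masses agree, [H] is the sum of [2 * (h' i ^+ 2 - h i * h' i)]; the bound
   [1 + t <= expR t] at [t = (g i - g' i) / 2] then applies termwise. *)
have HK : H <= \sum_(i | P i) expR (g' i) * (g' i - g i).
  have -> : H = \sum_(i | P i) (2 * (expR (g' i) - h i * h' i)).
    have -> : H = \sum_(i | P i) (expR (g i) + expR (g' i) - 2 * (h i * h' i)).
      by apply: eq_bigr => i _; rewrite hE hE'; ring.
    rewrite sumrB big_split /= Z -big_split -sumrB; apply: eq_bigr => i _ /=; ring.
  apply: ler_sum => i _.
  have e1 : h i = h' i * expR ((g i - g' i) / 2).
    by rewrite -expRD; congr expR; field.
  have := expR_ge1Dx ((g i - g' i) / 2); rewrite e1 hE'; set q := expR _ => hq.
  rewrite [leLHS](_ : _ = h' i ^+ 2 * (2 * (1 - q))); last by ring.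
  by rewrite ler_wpM2l ?sqr_ge0 //; lra.
have HB : \sum_(i | P i && B i) (h i - h' i) ^+ 2 <= H.
  rewrite [leRHS](bigID B) /= lerDl; apply: sumr_ge0 => i _; exact: sqr_ge0.
have HS : \sum_(i | P i && B i) (h i + h' i) ^+ 2 <= 2 * (N + M).
  rewrite -big_split mulr_sumr; apply: ler_sum => i _ /=; rewrite hE hE'.
  rewrite -subr_ge0 [X in 0 <= X](_ : _ = (h i - h' i) ^+ 2) ?sqr_ge0 //; ring.
have -> : N - M = \sum_(i | P i && B i) (h i - h' i) * (h i + h' i).
  by rewrite -sumrB; apply: eq_bigr => i _; rewrite hE hE'; ring.
apply: le_trans (cauchy_schwarz_sum _ _ _) _.
have NM : 2 * (N + M) <= 4 * Num.max N M.
  have : N <= Num.max N M by rewrite le_max lexx.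
  have : M <= Num.max N M by rewrite le_max lexx orbT.
  by lra.
rewrite mulrC; apply: ler_pM.
- by apply: sumr_ge0 => i _; exact: sqr_ge0.
- by apply: sumr_ge0 => i _; exact: sqr_ge0.
- exact: le_trans HS NM.
- exact: le_trans HB HK.
Qed.

End Hellinger.

(** * The entropy estimate on a finite graph of bounded degree *)

Section GraphBound.
Variables (R : realType) (V : finType) (o : V) (G : {set {set V}}) (bc T : R) (Delta : nat).
Hypothesis G2 : simple_edges G.
Hypothesis degG : forall y, (#|[set e in G | y \in e]| <= Delta)%N.
Hypothesis bc0 : 0 < bc.
Hypothesis triG : forall w, \sum_y \sum_z
  corr G bc [:: w; y] * corr G bc [:: y; z] * corr G bc [:: z; w] <= T.

(** The term at [o] of the bubble is 1. This lets contributions without a triangle, such as that of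
    [#|C|], be absorbed into multiples of [T]. *)
Lemma triangle_ge1 : 1 <= T.
Proof.
apply: le_trans (bubble_le bc0 triG o); rewrite (bigD1 o) //= corr_refl expr1n lerDl.
by apply: sumr_ge0 => u _; exact: sqr_ge0.
Qed.

Lemma card_cluster_edges (C : {set {set V}}) : C \subset G -> edge_cluster o C = C ->
  (#|C| <= Delta * #|vertex_cluster o C|)%N.
Proof.
move=> CG hC; rewrite mulnC -sum_nat_const.
apply: (@leq_trans (\sum_(y in vertex_cluster o C) #|[set e in C | y \in e]|)); last first.
  apply: leq_sum => y _; apply: leq_trans (degG y).
  by apply/subset_leq_card/subsetP => e; rewrite !inE => /andP[/(subsetP CG) -> ->].
rewrite (eq_bigr (fun y => \sum_(e in C) (y \in e : nat))%N); last first.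
  by move=> y _; rewrite -sum1dep_card big_mkcondr.
rewrite exchange_big /= -sum1_card; apply: leq_sum => e eC.
have /card_gt0P[y ye] : (0 < #|e|)%N by rewrite (G2 (subsetP CG _ eC)).
by rewrite (bigD1 y) ?ye //= (subsetP (ecluster_vcluster hC eC)).
Qed.

(** Bounds [4 e^{2s} / (e^{2s} - 1)^2] for [s] between [bc / 2] and [bc]: the numerator is taken at
    [bc], the denominator at [bc / 2]. *)
Definition edge_const : R := expR (bc * 2) * 4 / (expR bc - 1) ^+ 2.

Definition entropy_const : R := edge_const * Delta%:R + var_const bc Delta.

Lemma edge_const_gt0 : 0 < edge_const.
Proof.
apply: divr_gt0; first by rewrite mulr_gt0 ?expR_gt0.
rewrite exprn_gt0 // subr_gt0.
by rewrite -[X in X < _]expR0 ltr_expR.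
Qed.

Lemma var_const_ge0 : 0 <= var_const bc Delta.
Proof. by rewrite mulr_ge0 ?sqr_ge0. Qed.

Lemma ddlog_law_ge (C : {set {set V}}) (s : R) : C \subset G -> edge_cluster o C = C ->
  bc / 2 <= s -> s <= bc ->
  - (entropy_const * T * #|vertex_cluster o C|%:R) <= ddlog_law o G C s.
Proof.
move=> CG hC bs sb; have s0 : 0 <= s by apply: le_trans bs; rewrite divr_ge0 // ltW.
have hv := var_energy_inner G2 degG s0 sb bc0 triG (vertex_cluster o C) (subxx G).
have hc : #|C|%:R <= Delta%:R * #|vertex_cluster o C|%:R :> R.
  by rewrite -natrM ler_nat card_cluster_edges.
have rc : 0 < expR bc - 1 by rewrite subr_gt0 -[X in X < _]expR0 ltr_expR.
have rs : expR bc - 1 <= expR (s * 2) - 1 by rewrite lerB // ler_expR; lra.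
have h1 : expR (s * 2) * 4 / (expR (s * 2) - 1) ^+ 2 <= edge_const.
  apply: ler_pM; rewrite ?mulr_ge0 ?expR_ge0 ?invr_ge0 ?sqr_ge0 //.
    by rewrite ler_wpM2r // ler_expR; lra.
  rewrite lef_pV2 ?posrE ?exprn_gt0 // ?(lt_le_trans rc) //.
  by rewrite ler_pXn2r ?nnegrE ?(ltW rc) // ltW // (lt_le_trans rc).
have h2 : #|C|%:R * (expR (s * 2) * 4 / (expR (s * 2) - 1) ^+ 2)
    <= edge_const * Delta%:R * T * #|vertex_cluster o C|%:R.
  apply: (@le_trans _ _ (Delta%:R * #|vertex_cluster o C|%:R * edge_const)).
    apply: ler_pM => //.
    by apply: divr_ge0; rewrite ?sqr_ge0 // mulr_ge0 ?expR_ge0.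
  rewrite [leRHS](_ : _ = (Delta%:R * #|vertex_cluster o C|%:R * edge_const) * T); last by ring.
  apply: ler_peMr triangle_ge1.
  by apply: mulr_ge0 (ltW edge_const_gt0); exact: mulr_ge0.
rewrite /ddlog_law mulNr mulrN /entropy_const; rewrite /outer in hv *.
by lra.
Qed.

Lemma entropy_bound b b' : bc / 2 <= b' -> b' < b -> b <= bc ->
  \sum_(C in powerset G | edge_cluster o C == C)
     cluster_law o G b' C * (log_law o G C b' - log_law o G C b)
  <= entropy_const * T * (b - b') ^+ 2 *
     \sum_(C in powerset G | edge_cluster o C == C)
       cluster_law o G b' C * #|vertex_cluster o C|%:R.
Proof.
move=> bcb' b'b bbc.
have b'0 : 0 < b' by apply: lt_le_trans bcb'; rewrite divr_gt0.
have K0 : 0 <= entropy_const * T.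
  rewrite mulr_ge0 ?(le_trans ler01 triangle_ge1) // addr_ge0 ?var_const_ge0 //.
  by rewrite mulr_ge0 // ltW ?edge_const_gt0.
(* The first-order term has mean zero under the law at [b']. Subtracting it reduces the claim to a
   second-order Taylor bound for each cluster separately. *)
rewrite [leRHS](_ : _ = entropy_const * T * (b - b') ^+ 2 *
     (\sum_(C in powerset G | edge_cluster o C == C)
       cluster_law o G b' C * #|vertex_cluster o C|%:R)
   - (b - b') * \sum_(C in powerset G | edge_cluster o C == C)
       cluster_law o G b' C * dlog_law o G C b'); last first.
  by rewrite dlog_law_mean // mulr0 subr0.
rewrite !mulr_sumr -sumrB; apply: ler_sum => C; rewrite powersetE => /andP[CG /eqP hC].
have pos x : b' <= x -> 0 < x by exact: lt_le_trans.
have := @taylor2_ge R (log_law o G C) (dlog_law o G C) (ddlog_law o G C)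
  (entropy_const * T * #|vertex_cluster o C|%:R) b' b b'b.
have -> : 0 <= entropy_const * T * #|vertex_cluster o C|%:R by rewrite mulr_ge0.
move=> /(_ isT) H.
have {H} : dlog_law o G C b' * (b - b')
    - entropy_const * T * #|vertex_cluster o C|%:R * (b - b') ^+ 2
    <= log_law o G C b - log_law o G C b'.
  apply: H => x /andP[b'x xb].
  - by apply: log_law_derive => //; exact: pos.
  - by apply: dlog_law_derive => //; exact: pos.
  - by apply: ddlog_law_ge => //; [exact: le_trans b'x|exact: le_trans xb bbc].
have : 0 <= cluster_law o G b' C by rewrite log_lawK // expR_ge0.
set q := cluster_law _ _ _ _; set x := log_law _ _ _ _; set y := log_law _ _ _ _.
set z := dlog_law _ _ _ _ => q0 H.
have := ler_wpM2l q0 H; lra.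
Qed.

Definition event_prob (B : {set {set {set V}}}) (s : R) : R :=
  \sum_(C in powerset G | (edge_cluster o C == C) && (C \in B)) cluster_law o G s C.

(** Both sides are squared and [entropy_event] is combined with [entropy_bound]; the prefactor is
    the square root of [4 * entropy_const]. *)
Lemma cluster_event_bound (b b' : R) (B : {set {set {set V}}}) (p := event_prob B) :
  bc / 2 <= b' -> b' < b -> b <= bc ->
  `|p b - p b'| <= 2 * Num.sqrt entropy_const * `|b - b'| *
    Num.sqrt (T * Num.max (p b) (p b') *
      \sum_(C in powerset G | edge_cluster o C == C)
        cluster_law o G b' C * #|vertex_cluster o C|%:R).
Proof.
move=> bcb' b'b bbc.
have b'0 : 0 < b' by apply: lt_le_trans bcb'; rewrite divr_gt0.
have b0 : 0 < b by exact: lt_trans b'b.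
have lawK (s : R) C : 0 < s -> C \in powerset G -> cluster_law o G s C = expR (log_law o G C s).
  by move=> s0; rewrite powersetE; exact: log_lawK.
pose P C := (C \in powerset G) && (edge_cluster o C == C).
have pE (s : R) : 0 < s -> p s = \sum_(C | P C && (C \in B)) expR (log_law o G C s).
  move=> s0; rewrite /p /event_prob; apply: eq_big => C; first by rewrite /P andbA.
  by case/andP => CG _; rewrite lawK.
have sumE (s : R) : 0 < s -> \sum_(C | P C) expR (log_law o G C s) = 1.
  move=> s0; rewrite -(cluster_law_sum o G2 s); apply: eq_bigr => C /andP[CG _].
  by rewrite lawK.
have := @entropy_event R _ P (fun C => C \in B) (fun C => log_law o G C b)
  (fun C => log_law o G C b') (etrans (sumE b b0) (esym (sumE b' b'0))).
rewrite -!pE //.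
have := entropy_bound bcb' b'b bbc.
set H := \sum_(C in _ | _) _; set X := \sum_(C in _ | _) _ => HX.
have -> : \sum_(C | P C) expR (log_law o G C b') *
    (log_law o G C b' - log_law o G C b) = H.
  by apply: eq_bigr => C /andP[CG _]; rewrite lawK.
set M := Num.max _ _ => PM.
have M0 : 0 <= M.
  rewrite le_max; apply/orP; left; rewrite pE //.
  by apply: sumr_ge0 => C _; exact: expR_ge0.
have X0 : 0 <= X.
  apply: sumr_ge0 => C /andP[CG _]; rewrite lawK //.
  by rewrite mulr_ge0 ?expR_ge0.
have T0 : 0 <= T by exact: le_trans ler01 triangle_ge1.
have K0 : 0 <= entropy_const.
  by rewrite addr_ge0 ?var_const_ge0 // mulr_ge0 // ltW ?edge_const_gt0.
have R0 : 0 <= 2 * Num.sqrt entropy_const * `|b - b'| * Num.sqrt (T * M * X).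
  by rewrite !mulr_ge0 ?sqrtr_ge0.
rewrite -(ler_pXn2r (n := 2)) ?nnegrE // real_normK ?num_real //.
apply: le_trans PM _.
rewrite !exprMn !sqr_sqrtr // ?mulr_ge0 // real_normK ?num_real //.
rewrite [leRHS](_ : _ = 4 * M * (entropy_const * T * (b - b') ^+ 2 * X)); last by ring.
by rewrite ler_wpM2l // mulr_ge0.
Qed.

End GraphBound.

(** * The lattice *)

Section Lattice.
Variables (R : realType) (d : nat) (L : {fset 'rV[int]_d}).
Implicit Types (x y z : L).

Lemma nn_sym (a c : 'rV[int]_d) : nn a c = nn c a.
Proof.
by rewrite /nn; congr (_ == _); apply: eq_bigr => i _; rewrite -sqrrN opprB.
Qed.

Lemma nn_irrefl (a : 'rV[int]_d) : nn a a = false.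
Proof. by rewrite /nn big1 // => i _; rewrite subrr expr0n. Qed.

Lemma nn_coord (a c : 'rV[int]_d) i : nn a c -> `|a 0 i - c 0 i| <= 1.
Proof.
move=> /eqP H; rewrite -(ler_pXn2r (n := 2)) ?nnegrE // expr1n real_normK ?num_real //.
rewrite -H (bigD1 i) //= lerDl; apply: sumr_ge0 => j _; exact: sqr_ge0.
Qed.

Lemma lattice_edgesP e : e \in lattice_edges L ->
  exists x y, nn (val x) (val y) /\ e = [set x; y]%SET.
Proof. by case/imset2P => x y _; rewrite inE => /andP[_ xy] ->; exists x, y. Qed.

Lemma lattice_edges_simple : simple_edges (lattice_edges L).
Proof.
move=> e /lattice_edgesP[x [y [xy ->]]]; rewrite cards2.
by case: eqP => // xyE; move: xy; rewrite xyE nn_irrefl.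
Qed.

Lemma card_neighbours x : (#|[set y : L | nn (val x) (val y)]%SET| <= 3 ^ d)%N.
Proof.
(* The coordinates of [x - y] lie in {-1, 0, 1}; the shift by 1 makes them elements of ['I_3], so
   that neither [absz] nor [inord] loses information. *)
pose f y := [ffun i : 'I_d => inord (absz (val x 0 i - val y 0 i + 1)) : 'I_3].
have finj : {in [set y | nn (val x) (val y)]%SET &, injective f}.
  move=> y z; rewrite !inE => xy xz /ffunP fE; apply/val_inj/rowP => i.
  have := fE i; rewrite !ffunE => /(congr1 val) /=.
  have := nn_coord i xy; have := nn_coord i xz.
  have code_inj (p q r : int) : `|p - r| <= 1 -> `|p - q| <= 1 ->
      (inord (absz (p - q + 1)) : 'I_3) = (inord (absz (p - r + 1)) : 'I_3) :> nat -> q = r.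
    move=> hr hq.
    have bq : (absz (p - q + 1)%R < 3)%N by lia.
    have br : (absz (p - r + 1)%R < 3)%N by lia.
    by rewrite !inordK //; lia.
  exact: code_inj.
rewrite -(card_in_imset finj); apply: leq_trans (max_card _) _.
by rewrite card_ffun !card_ord.
Qed.

Lemma lattice_degree x :
  (#|[set e in lattice_edges L | x \in e]%SET| <= 3 ^ d)%N.
Proof.
apply: leq_trans (card_neighbours x).
pose S := [set y : L | nn (val x) (val y)]%SET.
apply: leq_trans (leq_imset_card (fun y : L => [set x; y]%SET) S).
apply/subset_leq_card/subsetP => e; rewrite inE => /andP[].
move=> /lattice_edgesP[y [z [yz ->]]]; rewrite !inE => /orP[/eqP xE|/eqP xE].
  by apply/imsetP; exists z; rewrite ?inE xE.
by apply/imsetP; exists y; rewrite ?inE xE 1?nn_sym // setUC.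
Qed.

Lemma two_pointE (b : R) x y :
  two_point b x y = corr (lattice_edges L) b [:: x; y].
Proof.
rewrite /two_point /ising_mean /gibbs_mean /corr /Zs /av.
rewrite -mulf_div divff ?invr_eq0 ?card_cfg_neq0 // mul1r; congr (_ / _).
  apply: eq_big => [s|s _]; first by rewrite in_setT.
  by rewrite !spinsE mulrC.
apply: eq_big => [s|s _]; first by rewrite in_setT.
by rewrite spins_nil mul1r.
Qed.

Lemma triangle_ub (bc : R) (w : L) : 0 <= bc ->
  \sum_y \sum_z corr (lattice_edges L) bc [:: w; y] *
    corr (lattice_edges L) bc [:: y; z] * corr (lattice_edges L) bc [:: z; w]
  <= triangle L bc.
Proof.
move=> bc0; pose F (x : L) : R := \sum_(y : L) \sum_(z : L)
      two_point bc x y * two_point bc y z * two_point bc z x.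
have F0 x : 0 <= F x.
  apply: sumr_ge0 => y _; apply: sumr_ge0 => z _; rewrite !two_pointE.
  by apply: mulr_ge0 (corr_ge0 _ _ bc0); apply: mulr_ge0; exact: corr_ge0.
have -> : \sum_y \sum_z corr (lattice_edges L) bc [:: w; y] *
    corr (lattice_edges L) bc [:: y; z] * corr (lattice_edges L) bc [:: z; w] = F w.
  by apply: eq_bigr => y _; apply: eq_bigr => z _; rewrite !two_pointE.
apply: ub_le_sup; last by exists w.
(* A supremum bounds its set only if the set has an upper bound; the sum of all the nonnegative
   [F x] is one. *)
exists (\sum_x F x) => _ [x _ <-]; rewrite -/(F x) [leRHS](bigD1 x) //= lerDl.
exact: sumr_ge0.
Qed.

End Lattice.

Unset Implicit Arguments.

Theorem theorem4p1 (R : realType) (d : nat) (hd : (2 <= d)%N) :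
  exists C : R, 0 < C /\
    forall (L : {fset 'rV[int]_d}) (h0 : 0 \in L)
           (A : {set {set {set L}}}) (b' b : R),
      let o : L := [` h0]%fset in
      let E := lattice_edges L in
      edge_cluster_measurable E o A ->
      beta_c R d / 2 <= b' -> b' < b -> b <= beta_c R d ->
      `|fk_prob E b A - fk_prob E b' A|
        <= C * `|b - b'|
             * Num.sqrt (triangle L (beta_c R d)
                         * Num.max (fk_prob E b A) (fk_prob E b' A)
                         * fk_mean E b' (fun w => #|vertex_cluster o w|%:R)).
Proof.
set bc := beta_c R d.
(* If [bc <= 0], no pair satisfies [bc / 2 <= b' < b <= bc], and any positive constant will do. *)
have [bc0|bc0] := leP bc 0.
  exists 1; split => // L h0 A b' b o E _ h1 h2 h3; exfalso; lra.
(* The degree bound [3 ^ d] depends on [d] alone, so the constant is uniform in [L]. *)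
exists (2 * Num.sqrt (entropy_const bc (3 ^ d))); split.
  rewrite mulr_gt0 // sqrtr_gt0 ltr_wpDr ?var_const_ge0 //.
  by rewrite mulr_gt0 ?edge_const_gt0 // ltr0n expn_gt0.
move=> L h0 A b' b o E [B AB] h1 h2 h3.
have E2 : simple_edges E by exact: lattice_edges_simple.
(* The event and the cluster size are both functions of the edge cluster, so both sides are
   expressed through its law. *)
have pE s : fk_prob E s A = event_prob o E B s.
  transitivity (fk_mean E s (fun w => (edge_cluster o w \in B)%:R)).
    rewrite /fk_prob /fk_mean /gibbs_mean; congr (_ / _).
    by apply: eq_bigr => w wE; rewrite AB inE wE.
  rewrite (fk_mean_cluster o E2 s (fun C => (C \in B)%:R)) /event_prob.
  under [RHS]eq_bigl do rewrite andbA.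
  rewrite [RHS]big_mkcondr; apply: eq_bigr => C _.
  by case: ifP; rewrite ?mulr1 ?mulr0.
have mE : fk_mean E b' (fun w => #|vertex_cluster o w|%:R) =
    \sum_(C in powerset E | edge_cluster o C == C)
      cluster_law o E b' C * #|vertex_cluster o C|%:R.
  rewrite -(fk_mean_cluster o E2 b' (fun C => #|vertex_cluster o C|%:R)).
  rewrite /fk_mean /gibbs_mean; congr (_ / _).
  by apply: eq_bigr => w _; rewrite vcluster_ecluster.
rewrite !pE mE; apply: cluster_event_bound => //.
- exact: lattice_degree.
- by move=> w; apply: triangle_ub; exact: ltW.
Qed.
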